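(* Let $\ell=3$, let $\mathcal{A}$ be an arrangement in $\mathbb{K}^3$, and let $a,b$ be non-negative integers. Then the following are equivalent (in each occurrence of alternative (i) below, the roles of $a$ and $b$ may be interchanged). (1) $\mathcal{A}$ is free with $\exp(\mathcal{A})=(1,a,b)$. (2) For any $H\in\mathcal{A}$, $\mathcal{A}':=\mathcal{A}\setminus\{H\}$ is either (i) free with $\exp(\mathcal{A}')=(1,a,b-1)$ and $|\mathcal{A}'|-|\mathcal{A}^H|=b-1$, or (ii) (strictly) plus-one generated with $\mathrm{POexp}(\mathcal{A}')=(1,a,b)$ and level $d=|\mathcal{A}'|-|\mathcal{A}^H|$. (3) For some $H\in\mathcal{A}$, $\mathcal{A}':=\mathcal{A}\setminus\{H\}$ is either (i) free with $\exp(\mathcal{A}')=(1,a,b-1)$ and $|\mathcal{A}'|-|\mathcal{A}^H|=b-1$, or (ii) (strictly) plus-one generated with $\mathrm{POexp}(\mathcal{A}')=(1,a,b)$ and level $d=|\mathcal{A}'|-|\mathcal{A}^H|$. (4) For any plane $L\notin\mathcal{A}$, $\mathcal{B}:=\mathcal{A}\cup\{L\}$ is either (i) free with $\exp(\mathcal{B})=(1,a,b+1)$ and $|\mathcal{B}^L|=a+1$, or (ii) (strictly) plus-one generated with $\mathrm{POexp}(\mathcal{B})=(1,a+1,b+1)$ and level $d=|\mathcal{B}^L|-1$. (5) For some plane $L\notin\mathcal{A}$, $\mathcal{B}:=\mathcal{A}\cup\{L\}$ is either (i) free with $\exp(\mathcal{B})=(1,a,b+1)$ and $|\mathcal{B}^L|=a+1$,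 or (ii) (strictly) plus-one generated with $\mathrm{POexp}(\mathcal{B})=(1,a+1,b+1)$ and level $d=|\mathcal{B}^L|-1$.
   Context: Let $\mathbb{K}$ be a field, $V=\mathbb{K}^\ell$, $S=\mathrm{Sym}^*(V^* )=\mathbb{K}[x_1,\ldots,x_\ell]$ and $\mathrm{Der}\,S=\bigoplus_{i=1}^\ell S\partial_{x_i}$. An arrangement $\mathcal{A}$ in $V$ is a finite set of linear hyperplanes in $V$ (for $\ell=3$: linear planes); arrangements are assumed essential ($\bigcap_{H\in\mathcal{A}}H=\{0\}$) unless otherwise specified. For $H\in\mathcal{A}$ fix $\alpha_H\in V^*$ with $\ker\alpha_H=H$, and let $\mathcal{A}^H:=\{L\cap H\mid L\in\mathcal{A}\setminus\{H\}\}$ be the restriction. $D(\mathcal{A}):=\{\theta\in\mathrm{Der}\,S\mid\theta(\alpha_H)\in S\alpha_H\ (\forall H\in\mathcal{A})\}$, graded by polynomial degree: $\sum f_i\partial_{x_i}$ is homogeneous of degree $d$ if all $f_i\in S_d$. $\mathcal{A}$ is free with exponents $\exp(\mathcal{A})=(d_1,\ldots,d_\ell)$ if $D(\mathcal{A})=\bigoplus_{i=1}^\ell S\theta_i$ with $\theta_i$ homogeneous of degree $d_i$; order of exponents is immaterial. $\theta_E=\sum_i x_i\partial_{x_i}$ is the Euler derivation. $\mathcal{A}$ is plus-one generated with exponents $\mathrm{POexp}(\mathcal{A})=(d_1,\ldots,d_\ell)$ and level $d$ if $D(\mathcal{A})$ has a minimal (graded) free resolution $$0\to S[-d-1]\xrightarrow{(\alpha,f_1,\ldots,f_\ell)}S[-d]\oplus\Big(\bigoplus_{i=1}^\ell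 S[-d_i]\Big)\to D(\mathcal{A})\to0,$$ i.e. there is a minimal set of homogeneous generators $\theta_1=\theta_E,\theta_2,\ldots,\theta_\ell,\varphi$ with $\deg\theta_i=d_i$ (so $d_1=1$), $\deg\varphi=d$, and a single relation (up to multiples) $\sum f_i\theta_i+\alpha\varphi=0$, $f_i\in S$, $\alpha\in V^*$. It is strictly plus-one generated if such a resolution can be chosen with $\alpha\ne0$. For $\ell=3$ plus-one generatedness and strict plus-one generatedness coincide, which is why ''strictly'' is in parentheses.
   Formalization: The equivalence of (1) with (4) and (5) is stated only when some plane L not in A exists; if K is finite and A consists of all planes, (4) holds vacuously and (5) fails, so the claim is false there. (1), (2), (3) are equivalent without this condition. *)

(* Defs.v *)
From HB Require Import structures.
From mathcomp Require Import all_boot all_order all_algebra.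
From mathcomp Require Import finmap mpoly.

Set Implicit Arguments.
Unset Strict Implicit.
Unset Printing Implicit Defensive.

Import GRing.Theory.
Local Open Scope ring_scope.

Definition is_hyperplane (K : fieldType) (l : nat) (H : {vspace 'rV[K]_l}) : Prop :=
  (\dim H).+1 = l.

Definition is_arrangement (K : fieldType) (l : nat)
    (A : {fset {vspace 'rV[K]_l}}) : Prop :=
  forall H, H \in A -> is_hyperplane H.

Definition essential (K : fieldType) (l : nat)
    (A : {fset {vspace 'rV[K]_l}}) : Prop :=
  (\bigcap_(H <- A) H)%VS = 0%VS.

(* The members of A^H are kept as subspaces of the ambient space V. *)
Definition restriction (K : fieldType) (l : nat)
    (A : {fset {vspace 'rV[K]_l}}) (H : {vspace 'rV[K]_l}) :
    {fset {vspace 'rV[K]_l}} :=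
  [fset (L :&: H)%VS | L in (A `\ H)%fset]%fset.

(* The inclusion of V^* = 'Hom(V, K) into S = Sym(V^* ) = K[x_1, ..., x_l]. *)
Definition linear_form (K : fieldType) (l : nat)
    (alpha : 'Hom('rV[K]_l, K^o)) : {mpoly K[l]} :=
  \sum_(i < l) alpha (delta_mx 0 i) *: 'X_i.

(* An element of Der S is the row of its coefficients on the d/dx_i. *)
Definition der_app (K : fieldType) (l : nat)
    (theta : 'rV[{mpoly K[l]}]_l) (p : {mpoly K[l]}) : {mpoly K[l]} :=
  \sum_(i < l) theta 0 i * p^`M(i).

Definition der_homog (K : fieldType) (l : nat) (d : nat)
    (theta : 'rV[{mpoly K[l]}]_l) : Prop :=
  forall i, theta 0 i \is d.-homog.

Definition euler (K : fieldType) (l : nat) : 'rV[{mpoly K[l]}]_l :=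
  \row_i 'X_i.

(* Membership in D(A). All alpha with kernel H are proportional, so that
   quantifying over them amounts to fixing one. *)
Definition log_der (K : fieldType) (l : nat) (A : {fset {vspace 'rV[K]_l}})
    (theta : 'rV[{mpoly K[l]}]_l) : Prop :=
  forall H, H \in A ->
  forall alpha : 'Hom('rV[K]_l, K^o), lker alpha = H ->
  exists g : {mpoly K[l]},
    der_app theta (linear_form alpha) = g * linear_form alpha.

Definition free_with_exp (K : fieldType) (l : nat)
    (A : {fset {vspace 'rV[K]_l}}) (d : l.-tuple nat) : Prop :=
  exists theta : 'I_l -> 'rV[{mpoly K[l]}]_l,
    [/\ forall i, log_der A (theta i) /\ der_homog (tnth d i) (theta i),
        forall eta, log_der A eta ->
          exists c : 'I_l -> {mpoly K[l]}, eta = \sum_i c i *: theta i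
      & forall c : 'I_l -> {mpoly K[l]},
          \sum_i c i *: theta i = 0 -> forall i, c i = 0].

(* p lies in S_(m - n), where S_k = 0 for k < 0. *)
Definition in_degree_diff (K : fieldType) (l : nat) (p : {mpoly K[l]})
    (m n : nat) : Prop :=
  if (m < n)%N then p = 0 else p \is (m - n)%N.-homog.

(* The data of a minimal graded free resolution
     0 -> S[-e-1] -> S[-e] (+) (+)_i S[-d_i] -> D(A) -> 0
   whose first map is (alpha, f_1, ..., f_l) and whose second map sends the
   basis to phi, theta_1 = theta_E, theta_2, ..., theta_l. The five groups of
   clauses after the one on theta_E are: the second map is well defined and
   graded, it is onto, the first map is graded and minimal (its entries lie in
   the irrelevant ideal, which holds for alpha as it is a linear form), it is
   injective, and the sequence is exact in the middle.
   With strict = true, alpha is moreover required to be nonzero. *)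
Definition plus_one_generated (K : fieldType) (l : nat) (strict : bool)
    (A : {fset {vspace 'rV[K]_l.+1}}) (d : l.+1.-tuple nat) (e : nat) : Prop :=
  exists (theta : 'I_l.+1 -> 'rV[{mpoly K[l.+1]}]_l.+1)
         (phi : 'rV[{mpoly K[l.+1]}]_l.+1)
         (f : 'I_l.+1 -> {mpoly K[l.+1]})
         (alpha : 'Hom('rV[K]_l.+1, K^o)),
    [/\ theta ord0 = euler K l.+1,
        (forall i, log_der A (theta i) /\ der_homog (tnth d i) (theta i))
          /\ (log_der A phi /\ der_homog e phi),
        forall eta, log_der A eta ->
          exists (c : 'I_l.+1 -> {mpoly K[l.+1]}) (c0 : {mpoly K[l.+1]}),
            eta = \sum_i c i *: theta i + c0 *: phi,
        forall i, in_degree_diff (f i) e.+1 (tnth d i) /\ (f i)@_0%MM = 0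
      & [/\ forall g : {mpoly K[l.+1]},
              (forall i, g * f i = 0) -> g * linear_form alpha = 0 -> g = 0,
            forall (c : 'I_l.+1 -> {mpoly K[l.+1]}) (c0 : {mpoly K[l.+1]}),
              \sum_i c i *: theta i + c0 *: phi = 0 <->
              exists g : {mpoly K[l.+1]},
                (forall i, c i = g * f i) /\ c0 = g * linear_form alpha
          & strict -> alpha != 0]].

(* Since b is a natural number, "0 < b" expresses that b - 1 is an exponent. *)
Definition free_deletion (K : fieldType) (A : {fset {vspace 'rV[K]_3}})
    (H : {vspace 'rV[K]_3}) (a b : nat) : Prop :=
  let A' := (A `\ H)%fset in
  [/\ (0 < b)%N,
      free_with_exp A' [tuple 1%N; a; b.-1]
    & (#|` A'| - #|` restriction A H| = b.-1)%N].

(* The truncated subtraction is harmless: A^H is an image of A'. *)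
Definition pog_deletion (K : fieldType) (strict : bool)
    (A : {fset {vspace 'rV[K]_3}}) (H : {vspace 'rV[K]_3}) (a b : nat) : Prop :=
  let A' := (A `\ H)%fset in
  plus_one_generated strict A' [tuple 1%N; a; b]
    (#|` A'| - #|` restriction A H|)%N.

Definition free_addition (K : fieldType) (A : {fset {vspace 'rV[K]_3}})
    (L : {vspace 'rV[K]_3}) (a b : nat) : Prop :=
  let B := (L |` A)%fset in
  free_with_exp B [tuple 1%N; a; b.+1] /\ #|` restriction B L| = a.+1.

Definition pog_addition (K : fieldType) (strict : bool)
    (A : {fset {vspace 'rV[K]_3}}) (L : {vspace 'rV[K]_3}) (a b : nat) : Prop :=
  let B := (L |` A)%fset in
  plus_one_generated strict B [tuple 1%N; a.+1; b.+1]
    (#|` restriction B L| - 1)%N.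

(* Main.v *)
Require Import Defs.
From HB Require Import structures.
From mathcomp Require Import all_boot all_order all_algebra.
From mathcomp Require Import finmap mpoly ring zify.

(* Let A be an arrangement in K^3, H a plane not in A with defining form
   alpha, A1 the union of A and H, n the cardinal of A and h that of the
   restriction A1^H. Two maps of graded modules into S/alpha control everything.
   - T : D(A) -> S/alpha sends theta to theta(alpha)/B, where B has degree
     n - h; its kernel is D(A1).
   - R : D(A1) -> S/alpha sends theta to det(theta_E, theta)|_H / Q, where Q, of
     degree h, defines A1^H; its kernel is S theta_E + alpha D(A).
   Suppose A1 is free with basis theta_E, theta_2, theta_3, and let r_2, r_3 be
   the values of R. If r_2 or r_3 vanishes, or is constant, one can arrange that
   theta_2 or theta_3 lies in S theta_E + alpha D(A), and A is free. Otherwise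
   r_3 theta_2 - r_2 theta_3 = u theta_E + alpha psi with psi in D(A) of degree
   n - h, because the exponents of A1 add up to n + 1. Hence T(psi) is a
   constant, nonzero by freeness, so that D(A) = D(A1) + S psi is plus-one
   generated. Exchanging the roles of T and R gives the addition of a plane.
   Conversely, in a plus-one generated module all coefficients of the relation
   other than that of theta_E are nonzero. So the level bounds the exponents, T
   (or R) takes constant values on the generators, and one of these values is
   nonzero. Subtracting multiples of that generator from the others puts them
   in the kernel, and the new relation eliminates the generator. *)

Set Implicit Arguments.
Unset Strict Implicit.
Unset Printing Implicit Defensive.

Import GRing.Theory.
Local Open Scope ring_scope.

(** * Homogeneous parts and divisibility *)

Section Homogeneous.
Context (K : fieldType) (n : nat).
Implicit Types (p q : {mpoly K[n]}) (d e k : nat).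

(** The two maps have complementary degrees: T lowers degrees by n - h and R by h - 1, and these add
    up to n - 1, the sum of the two remaining exponents of a free A. So a nonzero value of T bounds
    one exponent from below, a nonzero value of R bounds the other, and the known sum turns both
    bounds into equalities. This is where the cardinals in the free cases come from. The sum itself
    is obtained from determinants, in the manner of Saito. The kernel of R has its shape because a
    derivation tangent to the plane H and parallel to theta_E along H is a multiple of theta_E
    modulo alpha. A value in S/alpha is represented by a polynomial determined only modulo alpha.
    Hence T and R appear as relations between a derivation and a representative, and values are
    compared after the retraction [proj_subst]. Decompositions in D(A) come with arbitrary
    coefficients; homogeneous ones are recovered by taking components. *)

Definition homog_part d e p : {mpoly K[n]} :=
  if (d < e)%N then 0 else pihomog mdeg (d - e) p.

Lemma homog_partP d e p : in_degree_diff (homog_part d e p) d e.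
Proof.
by rewrite /in_degree_diff /homog_part; case: ltnP => // _; apply: pihomogP.
Qed.

Lemma pihomogM d e p q : q \is e.-homog ->
  pihomog mdeg d (p * q) = homog_part d e p * q.
Proof.
move=> hq; pose N := maxn (mmeasure mdeg p) (d - e).+1.
have hN : (mmeasure mdeg p <= N)%N by rewrite leq_maxl.
rewrite {1}(pihomog_partitionE hN) mulr_suml raddf_sum /=.
have part k : pihomog mdeg k p * q \is (k + e)%N.-homog.
  by apply: dhomogM => //; apply: pihomogP.
rewrite /homog_part; case: ltnP => hd.
  rewrite mul0r big1 // => i _; apply: (pihomog_ne0 (d := (i + e)%N)) => //.
  lia.
have lt : (d - e < N)%N by rewrite leq_max leqnn orbT.
rewrite (bigD1 (Ordinal lt)) //= big1 ?addr0 => [|i ne].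
  by apply: pihomog_dE; have := part (d - e)%N; rewrite subnK.
apply: (pihomog_ne0 (d := (i + e)%N)) => //.
by apply: contraNneq ne => h; apply/eqP/val_inj => /=; lia.
Qed.

Lemma in_degree_diff_mul d e p q : in_degree_diff p d e -> q \is e.-homog ->
  p * q \is d.-homog.
Proof.
rewrite /in_degree_diff; case: ltnP => [_ -> _|h hp hq].
  by rewrite mul0r dhomog0.
by have := dhomogM hp hq; rewrite subnK.
Qed.

Lemma in_degree_diff_ge d e p : in_degree_diff p d e -> p != 0 -> (e <= d)%N.
Proof. by rewrite /in_degree_diff; case: ltnP => // _ ->; rewrite eqxx. Qed.

Lemma in_degree_diff_homog d e p : in_degree_diff p d e -> p \is (d - e).-homog.
Proof. by rewrite /in_degree_diff; case: ltnP => // _ ->; apply: dhomog0. Qed.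

Lemma homog_in_degree_diff d e k p : p \is d.-homog -> (d + e = k)%N ->
  in_degree_diff p k e.
Proof. by move=> hp <-; rewrite /in_degree_diff ltnNge leq_addl addnK. Qed.

Lemma in_degree_diffZ (c : K) p d e : in_degree_diff p d e ->
  in_degree_diff (c *: p) d e.
Proof.
rewrite /in_degree_diff; case: ltnP => _; last exact: dhomogZ.
by move=> ->; rewrite scaler0.
Qed.

Lemma in_degree_diffN p d e : in_degree_diff p d e -> in_degree_diff (- p) d e.
Proof. by rewrite -scaleN1r; apply: in_degree_diffZ. Qed.

Lemma in_degree_diffS p d e : in_degree_diff p d.+1 e.+1 = in_degree_diff p d e.
Proof. by rewrite /in_degree_diff ltnS subSS. Qed.

(** The product can be nonzero only for d = e, where p is a constant; for d < e the polynomial p is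
    0. This keeps the coefficient of a generator linear when multiples of that generator are
    subtracted from the others. *)
Lemma in_degree_diff_scale_homog p q d e : in_degree_diff p d e ->
  (d <= e)%N -> q \is (e.+1 - d)%N.-homog -> p * q \is 1.-homog.
Proof.
move=> hp; rewrite leq_eqVlt => /orP[/eqP ed|de] hq.
  rewrite ed /in_degree_diff ltnn subnn in hp; rewrite ed subSnn in hq.
  exact: (dhomogM hp hq).
by rewrite /in_degree_diff de in hp; rewrite hp mul0r dhomog0.
Qed.

Lemma homog0_const p : p \is 0.-homog -> p = (p@_0%MM)%:MP.
Proof.
move=> hp; apply/mpolyP => m; rewrite mcoeffC.
have [->|ne] := eqVneq m 0%MM; first by rewrite mulr1.
by rewrite mulr0 (dhomog_nemf_coeff hp) // mdeg_eq0.
Qed.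

Lemma homog_coeff0 d p : p \is d.-homog -> (0 < d)%N -> p@_0%MM = 0.
Proof. by move=> hp hd; apply: (dhomog_nemf_coeff hp); rewrite /= mdeg0 neq_ltn hd. Qed.

Lemma coeff0M p q : (p * q)@_0%MM = p@_0%MM * q@_0%MM.
Proof. exact: rmorphM. Qed.

End Homogeneous.

Section Divisibility.
Context (R : idomainType).
Implicit Types (p q x y : R).

Definition divides p x := exists g, x = g * p.

(* [q] is a non-zero-divisor modulo [p]; between primes this is coprimality. *)
Definition cop p q := forall x, divides p (q * x) -> divides p x.

Lemma dividesD p x y : divides p x -> divides p y -> divides p (x + y).
Proof. by move=> [g ->] [k ->]; exists (g + k); rewrite mulrDl. Qed.

Lemma dividesN p x : divides p x -> divides p (- x).
Proof. by move=> [g ->]; exists (- g); rewrite mulNr. Qed.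

Lemma dividesB p x y : divides p x -> divides p y -> divides p (x - y).
Proof. by move=> px /dividesN; apply: dividesD. Qed.

Lemma divides_mull p x y : divides p y -> divides p (x * y).
Proof. by move=> [g ->]; exists (x * g); rewrite mulrA. Qed.

Lemma divides_mulr p x y : divides p x -> divides p (x * y).
Proof. by rewrite mulrC; apply: divides_mull. Qed.

Lemma divides_refl p : divides p p.
Proof. by exists 1; rewrite mul1r. Qed.

Lemma divides0 p : divides p 0.
Proof. by exists 0; rewrite mul0r. Qed.

Lemma divides1 x : divides 1 x.
Proof. by exists x; rewrite mulr1. Qed.

Lemma divides_sum p (I : Type) (r : seq I) (F : I -> R) :
  (forall i, divides p (F i)) -> divides p (\sum_(i <- r) F i).
Proof.
by move=> h; apply: (big_ind (divides p)) => //; [apply: divides0|apply: dividesD].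
Qed.

Lemma cop1 p : cop p 1.
Proof. by move=> x; rewrite mul1r. Qed.

Lemma copM p q q' : cop p q -> cop p q' -> cop p (q * q').
Proof. by move=> h h' x; rewrite -mulrA => /h /h'. Qed.

Lemma cop_prod (I : eqType) (r : seq I) p (P : pred I) (F : I -> R) :
  (forall i, i \in r -> P i -> cop p (F i)) -> cop p (\prod_(i <- r | P i) F i).
Proof.
move=> h; rewrite big_seq_cond; apply: big_ind; [exact: cop1|exact: copM|].
by move=> i /andP[]; apply: h.
Qed.

Lemma cop1l q : cop 1 q.
Proof. by move=> x _; apply: divides1. Qed.

Lemma copMl p p' q : p' != 0 -> cop p q -> cop p' q -> cop (p * p') q.
Proof.
move=> nz h h' x [g E].
have [y Ex] : divides p' x by apply: h'; rewrite E mulrA; apply/divides_mull/divides_refl.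
have [z Ey] : divides p y.
  by apply: h; exists g; apply: (mulIf nz); rewrite -mulrA -Ex E mulrA.
by exists z; rewrite Ex Ey mulrA.
Qed.

Lemma copX p q k : cop p q -> cop p (q ^+ k).
Proof.
move=> h; elim: k => [|k IH]; first by rewrite expr0; apply: cop1.
by rewrite exprS; apply: copM.
Qed.

Lemma copXl p q k : p != 0 -> cop p q -> cop (p ^+ k) q.
Proof.
move=> nz h; elim: k => [|k IH]; first by rewrite expr0; apply: cop1l.
by rewrite exprS; apply: copMl => //; apply: expf_neq0.
Qed.

Lemma cop_prodl (I : eqType) (r : seq I) q (P : pred I) (F : I -> R) :
  (forall i, i \in r -> P i -> F i != 0) ->
  (forall i, i \in r -> P i -> cop (F i) q) -> cop (\prod_(i <- r | P i) F i) q.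
Proof.
move=> nz h; rewrite big_seq_cond.
suff [] : \prod_(i <- r | (i \in r) && P i) F i != 0 /\
  cop (\prod_(i <- r | (i \in r) && P i) F i) q by [].
apply: (big_ind (fun p => p != 0 /\ cop p q)).
- by split; [apply: oner_neq0|apply: cop1l].
- move=> p p' [p0 hp] [p'0 hp']; split; first by rewrite mulf_neq0.
  exact: copMl.
- by move=> i /andP[ir Pi]; split; [apply: nz|apply: h].
Qed.

(** Replaces unique factorization: x is divided by one factor after the other, and the next factor
    divides the quotient because it is coprime to the product already removed. *)
Lemma prod_divides (I : eqType) (r : seq I) (F : I -> R) x :
  uniq r -> (forall i, i \in r -> divides (F i) x) ->
  (forall i j, i \in r -> j \in r -> i != j -> cop (F i) (F j)) ->
  divides (\prod_(i <- r) F i) x.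
Proof.
elim: r => [|i r IH] /=; first by rewrite big_nil => *; apply: divides1.
move=> /andP[ir ur] dv cp; rewrite big_cons.
have [||g Eg] := IH ur.
- by move=> j jr; apply: dv; rewrite inE jr orbT.
- by move=> j k jr kr; apply: cp; rewrite inE ?jr ?kr orbT.
have [k Ek] : divides (F i) g.
  have: cop (F i) (\prod_(j <- r) F j).
    apply: cop_prod => j jr _; apply: cp; rewrite ?inE ?eqxx ?jr ?orbT //.
    by apply: contraNneq ir => ->.
  by apply; rewrite mulrC -Eg; apply: dv; rewrite inE eqxx.
by exists k; rewrite Eg Ek mulrA.
Qed.

End Divisibility.

(** * Linear forms *)

Section LinearForms.
Context (K : fieldType) (l : nat).
Local Notation V := 'rV[K]_l.
Implicit Types (a b : 'Hom(V, K^o)) (v : V) (p q : {mpoly K[l]}).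

Lemma linear_formZ c a : linear_form (c *: a) = c *: linear_form a.
Proof.
rewrite /linear_form scaler_sumr; apply: eq_bigr => i _.
by rewrite lfunE /= scalerA.
Qed.

Lemma linear_formB a b : linear_form (a - b) = linear_form a - linear_form b.
Proof.
rewrite /linear_form -sumrB; apply: eq_bigr => i _.
by rewrite add_lfunE opp_lfunE scalerBl.
Qed.

Lemma linear_form0 : linear_form (0 : 'Hom(V, K^o)) = 0.
Proof. by rewrite -(subrr 0) linear_formB subrr. Qed.

Lemma coef_linear_form a i : (linear_form a)@_U_(i) = a (delta_mx 0 i).
Proof.
rewrite /linear_form raddf_sum /= (bigD1 i) //= big1 => [|j ji].
  by rewrite mcoeffZ mcoeffXU eqxx mulr1 addr0.
by rewrite mcoeffZ mcoeffXU (negbTE ji) mulr0.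
Qed.

Lemma form_sum a v : a v = \sum_i v 0 i * a (delta_mx 0 i).
Proof.
rewrite {1}[v]row_sum_delta linear_sum; apply: eq_bigr => i _.
by rewrite linearZ.
Qed.

Lemma form_shift a (c : K) u v : a (u - c *: v) = (a u : K) - c * a v.
Proof. by rewrite linearB linearZ. Qed.

Lemma shift_form b (c : K) a u : (b - c *: a) u = (b u : K) - c * a u.
Proof. by rewrite add_lfunE opp_lfunE scale_lfunE. Qed.

Lemma linear_form_inj : injective (@linear_form K l).
Proof.
move=> a b E; apply/lfunP => v; rewrite !form_sum; apply: eq_bigr => i _.
by rewrite -!coef_linear_form E.
Qed.

Lemma linear_form_eq0 a : (linear_form a == 0) = (a == 0).
Proof. by rewrite -linear_form0 (inj_eq linear_form_inj). Qed.

Lemma linear_form_homog a : linear_form a \is 1.-homog.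
Proof.
by apply: rpred_sum => i _; apply: dhomogZ; rewrite dhomogX; apply/eqP/mdeg1.
Qed.

Lemma form_normal a : a != 0 -> exists v, a v = 1.
Proof.
move=> /lfunPn[u]; rewrite lfunE /= => nz; exists ((a u : K)^-1 *: u).
by rewrite linearZ /=; apply: mulVf.
Qed.

Lemma form_coord a : a != 0 -> exists i, a (delta_mx 0 i) != 0.
Proof.
move=> nz; apply/existsP; apply: contraNT nz => /existsPn h.
apply/eqP/lfunP => v; rewrite form_sum lfunE /= big1 // => i _.
by rewrite (eqP (negbNE (h i))) mulr0.
Qed.

(* With [a v = 1] this is the retraction of S onto the polynomials that are
   constant along [v], modulo [a]: it realises S/(a) inside S. *)
Definition proj_subst a v : {mpoly K[l]} -> {mpoly K[l]} :=
  comp_mpoly [tuple 'X_i - v 0 i *: linear_form a | i < l].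

HB.instance Definition _ a v := GRing.RMorphism.copy (proj_subst a v)
  (comp_mpoly [tuple 'X_i - v 0 i *: linear_form a | i < l]).

Lemma proj_substX a v i :
  proj_subst a v 'X_i = 'X_i - v 0 i *: linear_form a.
Proof. by rewrite /proj_subst comp_mpolyXU -tnth_nth tnth_mktuple. Qed.

Lemma proj_substZ a v c p : proj_subst a v (c *: p) = c *: proj_subst a v p.
Proof. exact: comp_mpolyZ. Qed.

(** The substitution is the pullback along u -> u - a(u) v, which for a(v) = 1 is the projection
    along v onto the kernel of a. *)
Lemma proj_subst_form a v b :
  proj_subst a v (linear_form b) = linear_form (b - (b v : K) *: a).
Proof.
rewrite linear_formB linear_formZ {1 2}/linear_form raddf_sum /=.
rewrite [in X in _ - X]form_sum scaler_suml -sumrB; apply: eq_bigr => i _.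
by rewrite proj_substZ proj_substX scalerBr scalerA mulrC.
Qed.

Lemma proj_subst_mod a v p : divides (linear_form a) (p - proj_subst a v p).
Proof.
have mono m : divides (linear_form a) ('X_[m] - proj_subst a v 'X_[m]).
  rewrite mpolyXE_id /proj_subst rmorph_prod /=.
  elim/big_ind2: _ => [|q1 p1 q2 p2 h1 h2|i _].
  - by rewrite subrr; apply: divides0.
  - have -> : p1 * p2 - q1 * q2 = p2 * (p1 - q1) + q1 * (p2 - q2) by ring.
    by apply: dividesD; apply: divides_mull.
  - rewrite rmorphXn /= -[comp_mpoly _ _]/(proj_subst a v 'X_i) subrXX.
    apply: divides_mulr; rewrite proj_substX opprB addrC subrK.
    by exists (v 0 i)%:MP; rewrite mul_mpolyC.
elim/mpolyind: p => [|c m p _ _ IH].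
  by rewrite raddf0 subrr; apply: divides0.
rewrite raddfD /= proj_substZ opprD addrACA -scalerBr; apply: dividesD => //.
by rewrite -mul_mpolyC; apply: divides_mull.
Qed.

Lemma proj_subst_eq0 a v p : a v = 1 ->
  (proj_subst a v p = 0) <-> divides (linear_form a) p.
Proof.
move=> av; split=> [E|[g ->]].
  by have := proj_subst_mod a v p; rewrite E subr0.
rewrite rmorphM /= proj_subst_form av.
by rewrite scale1r subrr linear_form0 mulr0.
Qed.

Lemma proj_subst_homog a v d p : p \is d.-homog -> proj_subst a v p \is d.-homog.
Proof.
move=> hp; rewrite /proj_subst comp_mpolyEX big_seq; apply: rpred_sum => m mp.
apply: dhomogZ; rewrite comp_mpolyX -(dhomog_mf hp mp) /= mdegE.
elim/big_ind2: _ => [|d1 p1 d2 p2 h1 h2|i _].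
- exact: dhomog1.
- exact: dhomogM.
- rewrite -{2}[m i]mul1n; apply: dhomogMn; rewrite tnth_mktuple rpredB //.
    by rewrite dhomogX; apply/eqP/mdeg1.
  exact/dhomogZ/linear_form_homog.
Qed.

Lemma form_ndvd1 a : ~ divides (linear_form a) 1.
Proof.
move=> [g /(congr1 (mcoeff 0%MM))]; rewrite coeff0M.
rewrite (homog_coeff0 (linear_form_homog a)) // mulr0 mcoeff1 eqxx => /eqP.
by rewrite oner_eq0.
Qed.

(** The ideal of a linear form is the kernel of the ring morphism [proj_subst a v] into the domain
    S. *)
Lemma form_prime a p q : a != 0 -> divides (linear_form a) (p * q) ->
  divides (linear_form a) p \/ divides (linear_form a) q.
Proof.
move=> /form_normal[v av] /(proj_subst_eq0 _ av).
by rewrite rmorphM => /eqP; rewrite mulf_eq0 => /orP[]/eqP/(proj_subst_eq0 _ av);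
  [left|right].
Qed.

Lemma cop_form a p : a != 0 -> ~ divides (linear_form a) p ->
  cop (linear_form a) p.
Proof. by move=> nz np x /(form_prime nz)[]. Qed.

Lemma divides_form a b : a != 0 -> divides (linear_form a) (linear_form b) ->
  exists c : K, b = c *: a.
Proof.
move=> /form_normal[v av] /(proj_subst_eq0 _ av); rewrite proj_subst_form.
move/eqP; rewrite linear_form_eq0 subr_eq0 => /eqP E.
by exists (b v).
Qed.

Lemma lkerZ (c : K) a : c != 0 -> lker (c *: a) = lker a.
Proof.
move=> nz; apply/vspaceP => u; rewrite !memv_ker lfunE /= scaler_eq0.
by rewrite (negbTE nz).
Qed.

Lemma eq_lker_form a b : a != 0 -> lker a = lker b -> exists c : K, b = c *: a.
Proof.
move=> /form_normal[v av] E; exists (b v); apply/lfunP => u.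
have : u - (a u : K) *: v \in lker b.
  rewrite -E memv_ker linearB linearZ /= av subr_eq0; apply/eqP.
  by rewrite [RHS]mulr1.
rewrite memv_ker linearB linearZ subr_eq0 lfunE => /eqP->.
exact: mulrC.
Qed.

Lemma divides_form_lker a b : a != 0 -> b != 0 ->
  divides (linear_form a) (linear_form b) -> lker a = lker b.
Proof.
move=> a0 b0 /(divides_form a0)[c E]; rewrite E lkerZ //.
by apply: contraNneq b0 => c0; rewrite E c0 scale0r.
Qed.

Lemma eq_lker_divides a b p : a != 0 -> lker a = lker b ->
  divides (linear_form b) p -> divides (linear_form a) p.
Proof.
move=> a0 /(eq_lker_form a0)[c ->]; rewrite linear_formZ -mul_mpolyC.
by move=> [g ->]; exists (g * c%:MP); rewrite mulrA.
Qed.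

Lemma cop_forms a b : a != 0 -> b != 0 -> lker a != lker b ->
  cop (linear_form a) (linear_form b).
Proof.
move=> a0 b0 /eqP ne; apply: cop_form => //.
by move/(divides_form_lker a0 b0).
Qed.

Lemma dim_rV : \dim {:V} = l.
Proof. by rewrite dimvf dim_matrix; apply: mul1n. Qed.

(** A choice of alpha_H for all H at once: the component of a vector in a complement of H, which is
    a line when H is a hyperplane, read in a basis of that line. *)
Definition hform (H : {vspace V}) : 'Hom(V, K^o) :=
  (linfun (coord [tuple vpick (H^C)] ord0 : {linear V -> K^o})
    \o (\1 - projv H))%VF.

Lemma lker_hform (H : {vspace V}) : is_hyperplane H -> lker (hform H) = H.
Proof.
rewrite /is_hyperplane => hH; have d1 : \dim (H^C) = 1%N.
  by rewrite dimv_compl dim_rV -[X in (X - _)%N]hH subSnn.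
pose w := vpick (H^C).
have nw : w != 0 by rewrite vpick0 -dimv_eq0 d1.
have line : (H^C)%VS = <[w]>%VS.
  by apply/eqP; rewrite eq_sym eqEdim -memvE memv_pick d1 dim_vline nw.
have fw : free [tuple w] by rewrite free_cons span_nil memv0 nw nil_free.
apply/vspaceP => u; rewrite memv_ker comp_lfunE lfunE /= add_lfunE opp_lfunE id_lfunE.
apply/eqP/idP => [E|uH]; last by rewrite projv_id // subrr linear0.
have := memv_projC H u; rewrite line => /vlineP[c Ec].
move: E; rewrite Ec linearZ /= -[X in coord _ _ X]/([tuple w]`_(@ord0 0)).
rewrite coord_free // eqxx mulr1 => c0.
move/eqP: Ec; rewrite c0 scale0r subr_eq0 => /eqP->.
exact: memv_proj.
Qed.

Lemma hyperplane_form_neq0 (H : {vspace V}) a :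
  is_hyperplane H -> lker a = H -> a != 0.
Proof.
move=> hH E; apply/eqP => a0; move: hH; rewrite -E a0 /is_hyperplane.
have -> : lker (0 : 'Hom(V, K^o)) = fullv.
  by apply/vspaceP => u; rewrite memv_ker lfunE /= eqxx memvf.
by rewrite dim_rV => /eqP; rewrite eqn_leq ltnn.
Qed.

Lemma hform_neq0 (H : {vspace V}) : is_hyperplane H -> hform H != 0.
Proof. by move=> hH; apply: (hyperplane_form_neq0 hH); apply: lker_hform. Qed.

Definition coord_form (i : 'I_l) : 'Hom(V, K^o) :=
  linfun (coord [tuple delta_mx 0 j | j < l] i : {linear V -> K^o}).

Lemma coord_form_delta i j : coord_form i (delta_mx 0 j) = (i == j)%:R.
Proof.
set t := [tuple (delta_mx 0 j : V) | j < l].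
have nth_t (q : 'I_l) : t`_q = delta_mx 0 q by rewrite -tnth_nth tnth_mktuple.
have ft : free t.
  apply/freeP => c E m; move/rowP: E => /(_ m).
  rewrite summxE (bigD1 m) // nth_t !mxE !eqxx mulr1 big1 => [|q qm].
    by rewrite /= addr0.
  by rewrite nth_t !mxE eqxx (eq_sym m) (negbTE qm) mulr0.
by rewrite lfunE /= -(nth_t j) coord_free // eq_sym.
Qed.

Lemma linear_form_coord i : linear_form (coord_form i) = 'X_i.
Proof.
rewrite /linear_form (bigD1 i) //= big1 ?addr0 => [|j ji].
  by rewrite coord_form_delta eqxx scale1r.
by rewrite coord_form_delta eq_sym (negbTE ji) scale0r.
Qed.

Lemma coord_form_neq0 i : coord_form i != 0.
Proof.
apply/eqP => E; have := coord_form_delta i i.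
by rewrite E lfunE eqxx => /esym/eqP; rewrite oner_eq0.
Qed.

Lemma lker_coord_form i j : i != j -> lker (coord_form i) != lker (coord_form j).
Proof.
move=> ij; apply/eqP => E; have : delta_mx 0 j \in lker (coord_form i).
  by rewrite memv_ker coord_form_delta (negbTE ij).
by rewrite E memv_ker coord_form_delta eqxx oner_eq0.
Qed.

End LinearForms.

(** * Logarithmic derivations *)

Section LogDer.
Context (K : fieldType) (l : nat).
Local Notation V := 'rV[K]_l.
Local Notation S := {mpoly K[l]}.
Local Notation lf := (@linear_form K l).
Implicit Types (a b : 'Hom(V, K^o)) (v : V) (p q : S) (th et : 'rV[S]_l).
Implicit Types (A : {fset {vspace V}}) (H L : {vspace V}).

Lemma der_app_form th a : der_app th (lf a) = \sum_i a (delta_mx 0 i) *: th 0 i.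
Proof.
apply: eq_bigr => i _; rewrite /linear_form raddf_sum /= (bigD1 i) //= big1.
  rewrite addr0 mderivZ mderivX mnm1E eqxx scale1r -{1}[U_(i)%MM]add0m addmK.
  by rewrite mpolyX0 -scalerAr mulr1.
move=> j ji; rewrite mderivZ mderivX mnm1E (negbTE ji) scale0r.
by rewrite scaler0.
Qed.

Lemma der_appD th et p : der_app (th + et) p = der_app th p + der_app et p.
Proof. by rewrite /der_app -big_split; apply: eq_bigr => i _; rewrite mxE mulrDl. Qed.

Lemma der_appZ q th p : der_app (q *: th) p = q * der_app th p.
Proof. by rewrite /der_app mulr_sumr; apply: eq_bigr => i _; rewrite mxE mulrA. Qed.

Lemma der_appN th p : der_app (- th) p = - der_app th p.
Proof. by rewrite -scaleN1r der_appZ mulN1r. Qed.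

Lemma der_appB th et p : der_app (th - et) p = der_app th p - der_app et p.
Proof. by rewrite der_appD der_appN. Qed.

Lemma der_app_euler a : der_app (euler K l) (lf a) = lf a.
Proof. by rewrite der_app_form; apply: eq_bigr => i _; rewrite mxE. Qed.

Lemma der_appZr th (c : K) a : der_app th (lf (c *: a)) = c *: der_app th (lf a).
Proof.
rewrite !der_app_form scaler_sumr; apply: eq_bigr => i _.
by rewrite lfunE /= scalerA.
Qed.

Lemma der_appBr th a b :
  der_app th (lf (a - b)) = der_app th (lf a) - der_app th (lf b).
Proof.
rewrite !der_app_form -sumrB; apply: eq_bigr => i _.
by rewrite add_lfunE opp_lfunE scalerBl.
Qed.

Lemma der_app_homog d th a : der_homog d th -> der_app th (lf a) \is d.-homog.
Proof. by move=> hd; rewrite der_app_form; apply: rpred_sum => i _; apply: dhomogZ. Qed.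

Lemma log_derP A th : is_arrangement A -> log_der A th <->
  (forall H, H \in A -> divides (lf (hform H)) (der_app th (lf (hform H)))).
Proof.
move=> arrA; split=> [D H HA|D H HA a Ea].
  by apply: (D H HA); apply: lker_hform; apply: arrA.
have hH := arrA H HA; have a0 := hyperplane_form_neq0 hH Ea.
have [c E] : exists c : K, a = c *: hform H.
  by apply: eq_lker_form; rewrite ?hform_neq0 ?lker_hform.
apply: (eq_lker_divides (b := hform H)) => //; first by rewrite Ea lker_hform.
by rewrite E der_appZr -mul_mpolyC; apply/divides_mull/D.
Qed.

Lemma log_derD A th et : log_der A th -> log_der A et -> log_der A (th + et).
Proof.
move=> D D' H HA a Ea; rewrite der_appD.
by apply: dividesD; [apply: D Ea|apply: D' Ea].
Qed.

Lemma log_derZ A p th : log_der A th -> log_der A (p *: th).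
Proof. by move=> D H HA a Ea; rewrite der_appZ; apply/divides_mull/(D H HA). Qed.

Lemma log_derB A th et : log_der A th -> log_der A et -> log_der A (th - et).
Proof.
by move=> D D'; apply: log_derD => //; rewrite -scaleN1r; apply: log_derZ.
Qed.

Lemma log_der_euler A : log_der A (euler K l).
Proof. by move=> H HA a Ea; rewrite der_app_euler; apply: divides_refl. Qed.

Lemma log_der_fset1U A H a th : lker a = H -> is_hyperplane H ->
  log_der (H |` A)%fset th <->
  log_der A th /\ divides (lf a) (der_app th (lf a)).
Proof.
move=> Ea hH; split=> [D|[D Da] L].
  split; last by apply: (D H) => //; rewrite fset1U1.
  by move=> L LA; apply: D; rewrite fset1Ur.
rewrite in_fset1U => /orP[/eqP->|LA] b Eb; last exact: (D L).
have a0 := hyperplane_form_neq0 hH Ea.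
have [c E] : exists c : K, b = c *: a by apply: eq_lker_form; rewrite ?Ea ?Eb.
apply: (eq_lker_divides (b := a)); rewrite ?Ea ?Eb //.
  exact: hyperplane_form_neq0 Eb.
by rewrite E der_appZr -mul_mpolyC; apply/divides_mull.
Qed.

(** Since H is not in A, its form is coprime to the form of every member of A and can be
    cancelled. *)
Lemma log_der_cancel A H a th : is_arrangement A -> is_hyperplane H ->
  H \notin A -> lker a = H -> log_der A (lf a *: th) -> log_der A th.
Proof.
move=> arrA hH HA Ea /(log_derP _ arrA) D; apply/log_derP => // L LA.
have := D L LA; rewrite der_appZ; apply: cop_forms.
- exact/hform_neq0/arrA.
- exact: hyperplane_form_neq0 Ea.
- rewrite lker_hform; last exact: arrA.
  by rewrite Ea; apply: contraNneq HA => <-.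
Qed.

Definition der_part d th : 'rV[S]_l := map_mx (pihomog mdeg d) th.

Lemma der_partP d th : der_homog d (der_part d th).
Proof. by move=> i; rewrite mxE; apply: pihomogP. Qed.

Lemma der_part_id d th : der_homog d th -> der_part d th = th.
Proof. by move=> h; apply/rowP => i; rewrite mxE pihomog_dE. Qed.

Lemma der_partD d th et : der_part d (th + et) = der_part d th + der_part d et.
Proof. by apply/rowP => i; rewrite !mxE raddfD. Qed.

Lemma der_partZ d k p th : der_homog k th ->
  der_part d (p *: th) = homog_part d k p *: th.
Proof. by move=> h; apply/rowP => i; rewrite !mxE (pihomogM _ _ (h i)). Qed.

Lemma der_part_scale d p th : p \is 1.-homog ->
  der_part d.+1 (p *: th) = p *: der_part d th.
Proof.
move=> h; apply/rowP => i; rewrite !mxE mulrC (pihomogM _ _ h) /homog_part /=.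
by rewrite subSS subn0 mulrC.
Qed.

Lemma der_homogZ d k p th : in_degree_diff p d k -> der_homog k th ->
  der_homog d (p *: th).
Proof. by move=> hp h i; rewrite mxE; apply: in_degree_diff_mul hp (h i). Qed.

Lemma der_homogB d th et : der_homog d th -> der_homog d et -> der_homog d (th - et).
Proof. by move=> h h' i; rewrite !mxE rpredB. Qed.

Lemma euler_homog : der_homog 1 (euler K l).
Proof. by move=> i; rewrite mxE dhomogX; apply/eqP/mdeg1. Qed.

Definition defpoly A : S := \prod_(H <- A) lf (hform H).

Lemma prod_forms_homog (r : seq {vspace V}) (F : {vspace V} -> 'Hom(V, K^o)) :
  \prod_(H <- r) lf (F H) \is (size r).-homog.
Proof.
elim: r => [|H r IH] /=; first by rewrite big_nil dhomog1.
by rewrite big_cons; apply: (dhomogM (linear_form_homog (F H)) IH).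
Qed.

Lemma defpoly_homog A : defpoly A \is #|` A|.-homog.
Proof. exact: prod_forms_homog. Qed.

Lemma defpoly_neq0 A : is_arrangement A -> defpoly A != 0.
Proof.
move=> arrA; rewrite /defpoly prodf_seq_neq0; apply/allP => H HA /=.
by rewrite linear_form_eq0; apply/hform_neq0/arrA.
Qed.

Lemma log_der_defpoly A th : is_arrangement A -> log_der A (defpoly A *: th).
Proof.
move=> arrA; apply/log_derP => // H HA; rewrite der_appZ; apply: divides_mulr.
rewrite /defpoly (big_rem H) //=; exact/divides_mulr/divides_refl.
Qed.

Lemma cop_defpoly A H a : is_arrangement A -> is_hyperplane H -> H \notin A ->
  lker a = H -> cop (lf a) (defpoly A).
Proof.
move=> arrA hH HA Ea; have a0 := hyperplane_form_neq0 hH Ea.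
apply: cop_prod => L LA _; apply: cop_forms => //; first exact/hform_neq0/arrA.
rewrite Ea lker_hform; last exact: arrA.
by apply: contraNneq HA => ->.
Qed.

Lemma defpoly_ndvd A H a : is_arrangement A -> is_hyperplane H -> H \notin A ->
  lker a = H -> ~ divides (lf a) (defpoly A).
Proof.
move=> arrA hH HA Ea; rewrite -[defpoly A]mulr1.
by move/(cop_defpoly arrA hH HA Ea)/form_ndvd1.
Qed.

End LogDer.

(** * The trace of D(A) on a new hyperplane *)

Section Traces.
Context (K : fieldType) (l : nat).
Local Notation V := 'rV[K]_l.
Local Notation S := {mpoly K[l]}.
Local Notation lf := (@linear_form K l).
Context (A : {fset {vspace V}}) (H : {vspace V}) (a : 'Hom(V, K^o)) (v : V).
Hypotheses (arrA : is_arrangement A) (hH : is_hyperplane H) (HA : H \notin A).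
Hypotheses (Ea : lker a = H) (av : a v = 1).
Implicit Types (p q : S) (th et : 'rV[S]_l) (L X : {vspace V}).
Local Notation pr := (proj_subst a v).

Let a0 : a != 0 := hyperplane_form_neq0 hH Ea.

Lemma proj_subst_idem p : pr (pr p) = pr p.
Proof.
have /(proj_subst_eq0 _ av) := proj_subst_mod a v p.
by rewrite rmorphB /= => /eqP; rewrite subr_eq0 => /eqP.
Qed.

(* The form of [L] modified by a multiple of [a] so as to be constant along
   [v]; it defines the same subspace of [H]. *)
Definition bar_form L : 'Hom(V, K^o) := hform L - (hform L v : K) *: a.

Lemma proj_hform L : pr (lf (hform L)) = lf (bar_form L).
Proof. exact: proj_subst_form. Qed.

Lemma proj_bar_form L : pr (lf (bar_form L)) = lf (bar_form L).
Proof. by rewrite -proj_hform proj_subst_idem. Qed.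

(** The kernel of [bar_form L] is the span of v and the intersection of L with H, so it depends on L
    only through this intersection. *)
Lemma mem_bar_form L u : L \in A ->
  (u \in lker (bar_form L)) = (u - (a u : K) *: v \in (L :&: H)%VS).
Proof.
move=> LA; have EH w : (w \in H) = (a w == 0) by rewrite -memv_ker Ea.
have EL w : (w \in L) = (hform L w == 0) by rewrite -memv_ker (lker_hform (arrA LA)).
have au : a (u - (a u : K) *: v) = 0 by rewrite form_shift av mulr1 subrr.
rewrite memv_cap EH EL memv_ker au eqxx andbT.
by rewrite form_shift shift_form mulrC.
Qed.

Lemma eq_lker_bar_form L L' : L \in A -> L' \in A ->
  (lker (bar_form L) == lker (bar_form L')) = ((L :&: H)%VS == (L' :&: H)%VS).
Proof.
move=> LA L'A; apply/eqP/eqP => E; apply/vspaceP => u; last first.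
  by rewrite !mem_bar_form // E.
have [uH|uH] := boolP (u \in H); last by rewrite !memv_cap (negbTE uH) !andbF.
have au : a u = 0 by apply/eqP; rewrite -memv_ker Ea.
by move/vspaceP: E => /(_ u); rewrite !mem_bar_form // au scale0r subr0.
Qed.

Lemma bar_form_neq0 L : L \in A -> bar_form L != 0.
Proof.
move=> LA; apply: contraNneq HA => /eqP; rewrite subr_eq0 => /eqP E.
suff -> : H = L by [].
have c0 : (hform L v : K) != 0.
  apply: contraTneq (hform_neq0 (arrA LA)) => c0.
  by rewrite E c0 scale0r eqxx.
by rewrite -(lker_hform (arrA LA)) E lkerZ.
Qed.

Local Notation R := [fset (L :&: H)%VS | L in A]%fset.

Definition pencil X : seq {vspace V} := [seq L <- A | (L :&: H)%VS == X].
(** One plane of each pencil is set aside: [trace_poly] is made of the others, [restriction_poly] of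
    these. *)
Definition pencil_head X := head H (pencil X).

Lemma pencil_headP X : X \in R ->
  [/\ pencil_head X \in A, (pencil_head X :&: H)%VS = X &
      pencil X = pencil_head X :: behead (pencil X)].
Proof.
move=> /imfsetP[L /= LA EX]; rewrite /pencil_head.
have: L \in pencil X by rewrite mem_filter EX eqxx.
case Ep: (pencil X) => [//|M s] _ /=.
have: M \in pencil X by rewrite Ep inE eqxx.
by rewrite mem_filter => /andP[/eqP].
Qed.

Lemma pencilP X L : L \in pencil X -> L \in A /\ (L :&: H)%VS = X.
Proof. by rewrite mem_filter => /andP[/eqP]. Qed.

(* Terao's polynomial B: th(a) lies in the ideal (a, B) for every th in D(A). *)
Definition trace_poly : S :=
  \prod_(X <- R) \prod_(L <- behead (pencil X)) lf (hform L).

Lemma size_pencils : (\sum_(X <- R) size (pencil X) = #|` A|)%N.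
Proof.
under eq_bigr => X _ do rewrite size_filter -sum1_count big_mkcond.
rewrite exchange_big /= -sum1_size big_seq [RHS]big_seq.
apply: eq_bigr => L LA; rewrite -big_mkcond /= sum1_count.
rewrite (eq_count (a2 := pred1 (L :&: H)%VS)).
  rewrite count_uniq_mem ?fset_uniq //.
  by have -> : (L :&: H)%VS \in R by apply/imfsetP; exists L.
by move=> X /=; rewrite eq_sym.
Qed.

(** The pencils partition A, and each of them loses exactly one plane. *)
Lemma trace_poly_homog : trace_poly \is (#|` A| - #|` R|)%N.-homog.
Proof.
have -> : (#|` A| - #|` R| = \sum_(X <- R) size (behead (pencil X)))%N.
  rewrite -size_pencils -sum1_size big_seq [X in (_ - X)%N]big_seq.
  rewrite -sumnB => [|X /pencil_headP[_ _ ->] //].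
  by rewrite [RHS]big_seq; apply: eq_bigr => X _; rewrite size_behead subn1.
rewrite /trace_poly; elim: (enum_fset R) => [|X r IH].
  by rewrite !big_nil dhomog1.
by rewrite !big_cons; apply: dhomogM => //; apply: prod_forms_homog.
Qed.

Lemma proj_trace_poly :
  pr trace_poly = \prod_(X <- R) \prod_(L <- behead (pencil X)) lf (bar_form L).
Proof.
rewrite rmorph_prod; apply: eq_bigr => X _; rewrite rmorph_prod.
by apply: eq_bigr => L _; rewrite -proj_hform.
Qed.

Lemma proj_trace_poly_neq0 : pr trace_poly != 0.
Proof.
rewrite proj_trace_poly prodf_seq_neq0; apply/allP => X XR /=.
rewrite prodf_seq_neq0; apply/allP => L /mem_behead/pencilP[LA _] /=.
by rewrite linear_form_eq0 bar_form_neq0.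
Qed.

(** Let M be the head of the pencil and th(alpha_M) = g alpha_M. For another plane L of the pencil,
    alpha is a combination of alpha_L and alpha_M, so th(alpha) - g alpha is a multiple of
    th(alpha_L) - g alpha_L, hence of alpha_L. The same g serves for all L, and g alpha disappears
    on H. *)
Lemma trace_pencil X th : X \in R -> log_der A th ->
  divides (\prod_(L <- behead (pencil X)) lf (bar_form L))
    (pr (der_app th (lf a))).
Proof.
move=> XR /(log_derP _ arrA) D; have [MA MX Ep] := pencil_headP XR.
set M := pencil_head X in MA MX Ep.
have [g Eg] := D M MA.
have up : uniq (pencil X) by rewrite filter_uniq ?fset_uniq.
have : divides (\prod_(L <- behead (pencil X)) lf (hform L))
    (der_app th (lf a) - g * lf a).
  apply: prod_divides.
  - by move: up; rewrite Ep => /andP[].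
  - move=> L Ls; have [LA LX] := pencilP (mem_behead Ls).
    have LM : L != M.
      by apply: contraTneq up => E; rewrite Ep /= -E Ls.
    have [c Ec] : exists c : K, bar_form L = c *: bar_form M.
      apply: eq_lker_form; first exact: bar_form_neq0.
      by apply/eqP; rewrite eq_lker_bar_form // MX LX.
    (* The coefficient of alpha in alpha_L = c alpha_M + d alpha; it is nonzero because L and M
       differ. *)
    pose d : K := (hform L v : K) - c * (hform M v : K).
    have EL : lf (hform L) = c *: lf (hform M) + d *: lf a.
      move: (congr1 lf Ec); rewrite !(linear_formB, linear_formZ).
      move/eqP; rewrite subr_eq => /eqP->; rewrite -!mul_mpolyC /d mpolyCB mpolyCM.
      by ring.
    have ED : der_app th (lf (hform L)) =
        c *: der_app th (lf (hform M)) + d *: der_app th (lf a).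
      move: (congr1 (fun b => der_app th (lf b)) Ec); rewrite !(der_appBr, der_appZr).
      move/eqP; rewrite subr_eq => /eqP->; rewrite -!mul_mpolyC /d mpolyCB mpolyCM.
      by ring.
    have d0 : d != 0.
      apply: contraNneq LM => d0; move: EL.
      rewrite d0 scale0r addr0 -linear_formZ => /linear_form_inj EL.
      have c0 : c != 0.
        apply: contraTneq (hform_neq0 (arrA LA)) => c0.
        by rewrite EL c0 scale0r eqxx.
      by rewrite -(lker_hform (arrA LA)) EL lkerZ // lker_hform //; apply: arrA.
    have -> : der_app th (lf a) - g * lf a =
        d^-1%:MP * (der_app th (lf (hform L)) - g * lf (hform L)).
      have dV : d^-1%:MP * d%:MP = 1 :> S by rewrite -mpolyCM mulVf.
      rewrite ED EL Eg -!mul_mpolyC -[LHS]mul1r -dV; ring.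
    apply: divides_mull; apply: dividesB; first exact: D.
    exact/divides_mull/divides_refl.
  - move=> L L' /mem_behead/pencilP[LA _] /mem_behead/pencilP[L'A _] LL'.
    apply: cop_forms; rewrite ?hform_neq0 ?lker_hform //; exact: arrA.
move=> [k /(congr1 pr)]; rewrite rmorphB !rmorphM /= proj_subst_form av.
rewrite scale1r subrr linear_form0 mulr0 subr0 => ->; exists (pr k).
rewrite rmorph_prod; congr (_ * _); apply: eq_bigr => L _.
by rewrite -proj_hform.
Qed.

Lemma trace_divides th : log_der A th ->
  divides (pr trace_poly) (pr (der_app th (lf a))).
Proof.
move=> D; rewrite proj_trace_poly; apply: prod_divides.
- exact: fset_uniq.
- by move=> X XR; apply: trace_pencil.
move=> X Y XR YR XY; apply: cop_prodl => L /mem_behead/pencilP[LA LX] _.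
  by rewrite linear_form_eq0 bar_form_neq0.
apply: cop_prod => M /mem_behead/pencilP[MA MY] _.
apply: cop_forms; rewrite ?bar_form_neq0 //.
by rewrite eq_lker_bar_form // LX MY.
Qed.

Lemma trace_exists th : log_der A th ->
  exists t, pr (der_app th (lf a)) = pr t * pr trace_poly.
Proof.
move=> /trace_divides[t Et]; exists t.
by rewrite -[LHS]proj_subst_idem Et rmorphM /= proj_subst_idem.
Qed.

Lemma trace_exists_homog d th : log_der A th -> der_homog d th ->
  exists2 t, pr (der_app th (lf a)) = pr t * pr trace_poly &
    in_degree_diff t d (#|` A| - #|` R|).
Proof.
move=> /trace_divides[t Et] hd.
exists (homog_part d (#|` A| - #|` R|) t); last exact: homog_partP.
have hF : pr (der_app th (lf a)) \is d.-homog.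
  exact/proj_subst_homog/der_app_homog.
have hB : pr trace_poly \is (#|` A| - #|` R|).-homog.
  exact/proj_subst_homog/trace_poly_homog.
move: (congr1 (pihomog mdeg d) Et); rewrite pihomog_dE // (pihomogM _ _ hB).
move=> E; rewrite -[LHS]proj_subst_idem E rmorphM /=.
by rewrite proj_subst_idem.
Qed.

End Traces.

(** * Restriction of derivations to a hyperplane *)

Lemma ord3_exhaust (i j k m : 'I_3) : i != j -> i != k -> j != k ->
  [|| m == i, m == j | m == k].
Proof.
by case: i j k m => [[|[|[|//]]] ?] [[|[|[|//]]] ?] [[|[|[|//]]] ?] [[|[|[|//]]] ?].
Qed.

Lemma sum_ord3 (M : nmodType) (i j k : 'I_3) (F : 'I_3 -> M) :
  i != j -> i != k -> j != k -> \sum_m F m = F i + F j + F k.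
Proof.
move=> ij ik jk; rewrite (bigD1 i) //= (bigD1 j) 1?eq_sym //=.
rewrite (bigD1 k) /= ?(eq_sym k) ?ik //= big1 ?addr0 ?addrA // => m.
by have /or3P[/eqP->|/eqP->|/eqP->] := ord3_exhaust m ij ik jk; rewrite eqxx ?andbF.
Qed.

Lemma other_ords3 (i : 'I_3) : exists j k : 'I_3, [/\ i != j, i != k & j != k].
Proof.
by case: i => [[|[|[|//]]] lt_i];
  [exists 1, 2%:R|exists 0, 2%:R|exists 0, 1].
Qed.

Section EulerMinor.
Context (K : fieldType).
Local Notation V := 'rV[K]_3.
Local Notation S := {mpoly K[3]}.
Local Notation lf := (@linear_form K 3).
Context (A : {fset {vspace V}}) (H : {vspace V}) (a : 'Hom(V, K^o)).
Context (i j k : 'I_3).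
Hypotheses (arrA : is_arrangement A) (hH : is_hyperplane H) (HA : H \notin A).
Hypotheses (Ea : lker a = H) (ai : a (delta_mx 0 i) != 0).
Hypotheses (ij : i != j) (ik : i != k) (jk : j != k).
Implicit Types (p q : S) (th et : 'rV[S]_3) (L X : {vspace V}).

(** With v along the i-th axis, [proj_subst a v] fixes the variables j and k, which become
    coordinates on H. *)
Definition normal_vec : V := (a (delta_mx 0 i) : K)^-1 *: delta_mx 0 i.
Local Notation v := normal_vec.
Local Notation pr := (proj_subst a v).
Local Notation R := [fset (L :&: H)%VS | L in A]%fset.

Lemma normal_vecP : a v = 1.
Proof. by rewrite linearZ /=; apply: mulVf. Qed.
Let av := normal_vecP.
Let a0 : a != 0 := hyperplane_form_neq0 hH Ea.

(* The determinant of [th] and the Euler derivation, restricted to [H], in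
   the coordinates j and k of [H]. *)
Definition euler_minor th : S := 'X_j * th 0 k - 'X_k * th 0 j.

Lemma euler_minorD th et : euler_minor (th + et) = euler_minor th + euler_minor et.
Proof. by rewrite /euler_minor !mxE; ring. Qed.

Lemma euler_minorZ p th : euler_minor (p *: th) = p * euler_minor th.
Proof. by rewrite /euler_minor !mxE; ring. Qed.

Lemma euler_minorB th et : euler_minor (th - et) = euler_minor th - euler_minor et.
Proof. by rewrite /euler_minor !mxE; ring. Qed.

Lemma euler_minor_euler : euler_minor (euler K 3) = 0.
Proof. by rewrite /euler_minor !mxE; ring. Qed.

Lemma euler_minor_homog d th : der_homog d th -> euler_minor th \is d.+1.-homog.
Proof.
move=> h; have hX m : 'X_m \is [in K[3], 1.-homog] by rewrite dhomogX; apply/eqP/mdeg1.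
by apply: rpredB; apply: (dhomogM (hX _) (h _)).
Qed.

Lemma proj_X m : m != i -> pr 'X_m = 'X_m.
Proof.
by move=> mi; rewrite proj_substX !mxE eqxx (negbTE mi) mulr0 scale0r subr0.
Qed.

Lemma bar_form_i L : bar_form a v L (delta_mx 0 i) = 0.
Proof.
rewrite shift_form; have -> : (hform L v : K) =
    (a (delta_mx 0 i) : K)^-1 * hform L (delta_mx 0 i) by rewrite linearZ.
by rewrite mulrAC mulVf // mul1r subrr.
Qed.

(** On H the derivation th and the Euler derivation are both tangent to the line b = 0, so their
    determinant vanishes there. Explicitly, b_k times the minor is x_j th(b) - b th_j, and b_j times
    it is b th_k - x_k th(b); one of b_j and b_k is nonzero. *)
Lemma euler_minor_pencil L th : L \in A -> log_der (H |` A)%fset th ->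
  divides (lf (bar_form a v L)) (pr (euler_minor th)).
Proof.
move=> LA /(log_der_fset1U _ _ Ea hH)[/(log_derP _ arrA)/(_ L LA)[g Eg] [g' Eg']].
set b := bar_form a v L.
have Eb : lf b = b (delta_mx 0 j) *: 'X_j + b (delta_mx 0 k) *: 'X_k.
  by rewrite /linear_form (sum_ord3 _ ij ik jk) bar_form_i scale0r add0r.
have Db : der_app th (lf b) =
    b (delta_mx 0 j) *: th 0 j + b (delta_mx 0 k) *: th 0 k.
  by rewrite der_app_form (sum_ord3 _ ij ik jk) bar_form_i scale0r add0r.
have pDb : pr (der_app th (lf b)) = pr g * lf b.
  rewrite der_appBr der_appZr Eg Eg' rmorphB /= proj_substZ !rmorphM /=.
  rewrite proj_hform proj_subst_form av.
  by rewrite scale1r subrr linear_form0 mulr0 scaler0 subr0.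
have pb : pr (lf b) = lf b by apply: proj_bar_form.
have unscale (c : K) x : c != 0 -> divides (lf b) (c *: x) -> divides (lf b) x.
  move=> c0 [y Ey]; exists (c^-1 *: y).
  by rewrite -scalerAl -Ey scalerA mulVf // scale1r.
have := bar_form_neq0 v arrA HA Ea LA; rewrite -linear_form_eq0 -/b {1}Eb.
have [bk0|bk] := eqVneq (b (delta_mx 0 k) : K) 0; last first.
  move=> _; apply: (unscale _ _ bk); rewrite -proj_substZ.
  have -> : (b (delta_mx 0 k) : K) *: euler_minor th =
      'X_j * der_app th (lf b) - lf b * th 0 j.
    by rewrite Db Eb /euler_minor -!mul_mpolyC; ring.
  rewrite rmorphB !rmorphM /= pDb pb; apply: dividesB.
    exact/divides_mull/divides_mull/divides_refl.
  exact/divides_mulr/divides_refl.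
rewrite bk0 scale0r addr0 => /negP bj.
have {bj}bj : (b (delta_mx 0 j) : K) != 0.
  by apply/negP => /eqP E; apply: bj; rewrite E scale0r.
apply: (unscale _ _ bj); rewrite -proj_substZ.
have -> : (b (delta_mx 0 j) : K) *: euler_minor th =
    lf b * th 0 k - 'X_k * der_app th (lf b).
  by rewrite Db Eb /euler_minor -!mul_mpolyC; ring.
rewrite rmorphB !rmorphM /= pDb pb; apply: dividesB.
  exact/divides_mulr/divides_refl.
exact/divides_mull/divides_mull/divides_refl.
Qed.

Definition restriction_poly : S :=
  \prod_(X <- R) lf (bar_form a v (pencil_head A H X)).

Lemma restriction_poly_homog : restriction_poly \is #|` R|.-homog.
Proof. exact: prod_forms_homog. Qed.

Lemma proj_restriction_poly : pr restriction_poly = restriction_poly.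
Proof.
by rewrite rmorph_prod; apply: eq_bigr => X _; apply: proj_bar_form.
Qed.

Lemma restriction_poly_neq0 : restriction_poly != 0.
Proof.
rewrite prodf_seq_neq0; apply/allP => X /pencil_headP[LA _ _] /=.
by rewrite linear_form_eq0 (bar_form_neq0 v arrA HA Ea).
Qed.

Lemma euler_minor_divides th : log_der (H |` A)%fset th ->
  divides restriction_poly (pr (euler_minor th)).
Proof.
move=> D; apply: prod_divides; first exact: fset_uniq.
  by move=> X /pencil_headP[LA _ _]; apply: euler_minor_pencil.
move=> X Y /pencil_headP[LA EX _] /pencil_headP[MA EY _] XY.
apply: cop_forms; rewrite ?(bar_form_neq0 v arrA HA Ea) //.
by rewrite (eq_lker_bar_form arrA Ea av) // EX EY.
Qed.

Lemma euler_minor_exists th : log_der (H |` A)%fset th ->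
  exists r, pr (euler_minor th) = pr r * restriction_poly.
Proof.
move=> /euler_minor_divides[r Er]; exists r.
rewrite -[LHS](proj_subst_idem av) Er rmorphM /=.
by rewrite proj_restriction_poly.
Qed.

Lemma euler_minor_exists_homog d th :
  log_der (H |` A)%fset th -> der_homog d th ->
  exists2 r, pr (euler_minor th) = pr r * restriction_poly &
    in_degree_diff r d.+1 #|` R|.
Proof.
move=> /euler_minor_divides[r Er] hd.
exists (homog_part d.+1 #|` R| r); last exact: homog_partP.
have hF : pr (euler_minor th) \is d.+1.-homog.
  exact/proj_subst_homog/euler_minor_homog.
move: (congr1 (pihomog mdeg d.+1) Er); rewrite pihomog_dE //.
rewrite (pihomogM _ _ restriction_poly_homog) => E.
rewrite -[LHS](proj_subst_idem av) E rmorphM /=.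
by rewrite proj_restriction_poly.
Qed.

(** Modulo alpha, x_j th_k = x_k th_j with x_j and x_k coprime, so th_j and th_k are u x_j and u x_k
    for a common u. Then th - u E is divisible by alpha, and the quotient is in D(A) by
    [log_der_cancel]. *)
Lemma euler_minor_eq0 th : log_der (H |` A)%fset th -> pr (euler_minor th) = 0 ->
  exists u psi, log_der A psi /\ th = u *: euler K 3 + lf a *: psi.
Proof.
move=> D E; have [DA dv] := (log_der_fset1U A th Ea hH).1 D.
have [u [uj uk]] : exists u, pr (th 0 j) = pr u * 'X_j /\ pr (th 0 k) = pr u * 'X_k.
  have pXj : pr 'X_j = 'X_j by rewrite proj_X // eq_sym.
  have pXk : pr 'X_k = 'X_k by rewrite proj_X // eq_sym.
  move: E; rewrite /euler_minor rmorphB !rmorphM /= pXj pXk => /eqP.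
  rewrite subr_eq0 => /eqP E.
  have [u Eu] : divides 'X_j (pr (th 0 j)).
    have : cop ('X_j : S) 'X_k.
      rewrite -!linear_form_coord; apply: cop_forms; rewrite ?coord_form_neq0 //.
      exact: lker_coord_form.
    by apply; rewrite -E; apply/divides_mulr/divides_refl.
  have uj : pr (th 0 j) = pr u * 'X_j.
    by rewrite -[LHS](proj_subst_idem av) Eu rmorphM /= pXj.
  exists u; split=> //.
  have Xj0 : 'X_j != 0 :> S by rewrite -linear_form_coord linear_form_eq0 coord_form_neq0.
  by apply: (mulfI Xj0); rewrite E uj; ring.
have dj : divides (lf a) (th 0 j - u * 'X_j).
  apply/(proj_subst_eq0 _ av); rewrite rmorphB rmorphM /=.
  by rewrite uj (proj_X (m := j)) 1?eq_sym // subrr.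
have dk : divides (lf a) (th 0 k - u * 'X_k).
  apply/(proj_subst_eq0 _ av); rewrite rmorphB rmorphM /=.
  by rewrite uk (proj_X (m := k)) 1?eq_sym // subrr.
(* The value of th - u E on alpha is divisible by alpha, as are its coefficients j and k; the
   coefficient i follows since a_i is invertible. *)
have di : divides (lf a) (th 0 i - u * 'X_i).
  have dd : divides (lf a) (der_app (th - u *: euler K 3) (lf a)).
    rewrite der_appB der_appZ der_app_euler; apply: dividesB => //.
    exact/divides_mull/divides_refl.
  move: dd; rewrite der_app_form (sum_ord3 _ ij ik jk) !mxE.
  set x := th 0 i - _; set y := th 0 j - _ in dj *; set z := th 0 k - _ in dk *.
  move=> dd; have -> : x = (a (delta_mx 0 i) : K)^-1%:MP *
     (((a (delta_mx 0 i) : K) *: x + (a (delta_mx 0 j) : K) *: y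
        + (a (delta_mx 0 k) : K) *: z)
     - (a (delta_mx 0 j) : K)%:MP * y - (a (delta_mx 0 k) : K)%:MP * z).
    rewrite -!mul_mpolyC addrAC addrK addrK mulrA -mpolyCM mulVf //.
    by rewrite mul1r.
  by apply/divides_mull/dividesB; [apply: dividesB|]; rewrite ?mul_mpolyC //;
     rewrite -mul_mpolyC; apply: divides_mull.
have : forall m, exists g, th 0 m - u * 'X_m = g * lf a.
  by move=> m; have /or3P[/eqP->|/eqP->|/eqP->] := ord3_exhaust m ij ik jk.
move=> /fin_all_exists[g Eg]; exists u, (\row_m g m).
have Eth : th = u *: euler K 3 + lf a *: \row_m g m.
  by apply/rowP => m; rewrite !mxE mulrC [lf a * _]mulrC -Eg; ring.
split=> //; apply: (log_der_cancel arrA hH HA Ea).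
rewrite (_ : _ *: _ = th - u *: euler K 3); last by rewrite Eth addrC addKr.
by apply: log_derB => //; apply/log_derZ/log_der_euler.
Qed.

(** The component of degree d + 1 of a decomposition is again one. That the component of psi lies in
    D(A) is obtained by cancelling alpha once more. *)
Lemma euler_minor_eq0_homog d th : log_der (H |` A)%fset th -> der_homog d.+1 th ->
  pr (euler_minor th) = 0 ->
  exists u psi, [/\ log_der A psi, th = u *: euler K 3 + lf a *: psi,
    u \is d.-homog & der_homog d psi].
Proof.
move=> D hd /(euler_minor_eq0 D)[u [psi [Dpsi E]]].
have E' : th = pihomog mdeg d u *: euler K 3 + lf a *: der_part d psi.
  rewrite -(der_part_id hd) E der_partD (der_partZ _ _ (@euler_homog K 3)).
  by rewrite (der_part_scale _ _ (linear_form_homog a)) /homog_part /= subn1.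
exists (pihomog mdeg d u), (der_part d psi); split=> //.
- apply: (log_der_cancel arrA hH HA Ea).
  rewrite (_ : _ *: _ = th - pihomog mdeg d u *: euler K 3); last first.
    by rewrite E' addrC addKr.
  apply: log_derB; last exact/log_derZ/log_der_euler.
  exact: ((log_der_fset1U A th Ea hH).1 D).1.
- exact: pihomogP.
- exact: der_partP.
Qed.

End EulerMinor.

(** * Saito's criterion: the sum of the exponents *)

Section Saito.
Context (K : fieldType) (l : nat).
Local Notation V := 'rV[K]_l.
Local Notation S := {mpoly K[l]}.
Local Notation lf := (@linear_form K l).
Implicit Types (a : 'Hom(V, K^o)) (p q : S) (th et : 'rV[S]_l).
Implicit Types (A : {fset {vspace V}}) (H L : {vspace V}).

Lemma is_arrangementD1 A H : is_arrangement A -> is_arrangement (A `\ H)%fset.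
Proof. by move=> arrA L; rewrite in_fsetD1 => /andP[_]; apply: arrA. Qed.

Lemma defpolyD1 A H : H \in A ->
  defpoly A = lf (hform H) * defpoly (A `\ H)%fset.
Proof. by move=> HA; rewrite /defpoly (big_fsetD1 H). Qed.

Lemma der_app_delta i a : der_app (delta_mx 0 i) (lf a) = (a (delta_mx 0 i))%:MP.
Proof.
rewrite der_app_form (bigD1 i) //= big1 => [|j ji].
  by rewrite mxE !eqxx -mul_mpolyC mulr1 addr0.
by rewrite mxE (negbTE ji) andbF scaler0.
Qed.

Lemma det_rows_homog (d : 'I_l -> nat) (th : 'I_l -> 'rV[S]_l) :
  (forall i, der_homog (d i) (th i)) ->
  \det (\matrix_(i, j) th i 0 j) \is (\sum_i d i)%N.-homog.
Proof.
move=> hd; rewrite /determinant; apply: rpred_sum => s _; rewrite rpredMsign.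
elim/big_ind2: _ => [|d1 p1 d2 p2|i _]; first exact: dhomog1.
  exact: dhomogM.
by rewrite mxE; apply: hd.
Qed.

(** The matrix sends the column of coefficients of alpha_H to the column of the th_m(alpha_H), all
    divisible by alpha_H. Multiplying by the adjugate makes the determinant times each coefficient
    divisible by alpha_H, and some coefficient is a nonzero constant. *)
Lemma log_der_det A (th : 'I_l -> 'rV[S]_l) : is_arrangement A ->
  (forall i, log_der A (th i)) ->
  divides (defpoly A) (\det (\matrix_(i, j) th i 0 j)).
Proof.
move=> arrA D; set M := \matrix_(i, j) _.
apply: prod_divides; first exact: fset_uniq.
  move=> H HA; have [i ai] := form_coord (hform_neq0 (arrA _ HA)).
  have /fin_all_exists[g Eg] : forall m, exists g,
      der_app (th m) (lf (hform H)) = g * lf (hform H).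
    by move=> m; apply: (D m H HA); apply: lker_hform (arrA _ HA).
  pose c : 'cV[S]_l := \col_j (hform H (delta_mx 0 j) : K)%:MP.
  have Mc : M *m c = \col_m (g m * lf (hform H)).
    apply/colP => m; rewrite !mxE -Eg der_app_form; apply: eq_bigr => j _.
    by rewrite !mxE mulrC mul_mpolyC.
  have : \adj M *m (M *m c) = \det M *: c by rewrite mulmxA mul_adj_mx mul_scalar_mx.
  move/colP/(_ i); rewrite Mc !mxE => E.
  have -> : \det M = (hform H (delta_mx 0 i) : K)^-1%:MP *
      (\det M * (hform H (delta_mx 0 i) : K)%:MP).
    by rewrite mulrCA -mpolyCM mulVf // mulr1.
  rewrite -E; apply: divides_mull; apply: divides_sum => j.
  by rewrite [X in _ * X]mxE; apply/divides_mull/divides_mull/divides_refl.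
move=> H L HA LA HL; apply: cop_forms; rewrite ?hform_neq0 //; try exact: arrA.
by rewrite !lker_hform //; apply: arrA.
Qed.

(* In coordinates with [a] the i-th one, these are the derivations d/dx_m
   for m different from i, and a d/dx_i. *)
Definition adapted_mx a (i : 'I_l) : 'M[S]_l :=
  \matrix_(m, j) if m == i then (j == i)%:R * lf a else
    (j == m)%:R - (j == i)%:R * (a (delta_mx 0 m) / (a (delta_mx 0 i) : K))%:MP.

Lemma det_adapted_mx a i : \det (adapted_mx a i) = lf a.
Proof.
rewrite (expand_det_row _ i) (bigD1 i) //= big1 => [|j ji]; last first.
  by rewrite mxE eqxx (negbTE ji) !mul0r.
rewrite mxE !eqxx mul1r addr0 /cofactor addnn -signr_odd odd_double mul1r.
rewrite (_ : row' i _ = 1%:M) ?det1 ?mulr1 //.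
apply/matrixP => p q; rewrite !mxE eq_sym (negbTE (neq_lift _ _)).
rewrite eq_sym [lift i q == i]eq_sym (negbTE (neq_lift _ _)) mul0r subr0.
by rewrite (inj_eq lift_inj).
Qed.

Lemma adapted_mx_log_der A H a i m : is_arrangement A -> is_hyperplane H ->
  lker a = H -> a (delta_mx 0 i) != 0 ->
  log_der (H |` A)%fset (defpoly A *: row m (adapted_mx a i)).
Proof.
move=> arrA hH Ea ai; apply/(log_der_fset1U _ _ Ea hH).
split; first exact: log_der_defpoly.
rewrite der_appZ; apply: divides_mull.
have [->|mi] := eqVneq m i.
  have -> : row i (adapted_mx a i) = lf a *: delta_mx 0 i.
    by apply/rowP => j; rewrite !mxE eqxx mulrC.
  by rewrite der_appZ mulrC; apply/divides_mull/divides_refl.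
have -> : row m (adapted_mx a i) = delta_mx 0 m -
    (a (delta_mx 0 m) / (a (delta_mx 0 i) : K))%:MP *: delta_mx 0 i.
  by apply/rowP => j; rewrite !mxE (negbTE mi) /= mulrC.
rewrite der_appB der_appZ !der_app_delta -mpolyCM divfK // subrr.
exact: divides0.
Qed.

(** Let Q be [defpoly A] and f the quotient of the determinant by Q; the point is that f is a unit.
    With Q' = Q / alpha_H, the rows of Q' times [adapted_mx] lie in D(A), and expanding them in the
    generators shows that f divides Q' to the power l - 1, for every H in A. *)
Lemma saito_degree A (d : 'I_l -> nat) (th : 'I_l -> 'rV[S]_l) :
  is_arrangement A -> A != fset0 ->
  (forall i, log_der A (th i) /\ der_homog (d i) (th i)) ->
  (forall et, log_der A et -> exists c : 'I_l -> S, et = \sum_i c i *: th i) ->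
  (\sum_i d i = #|` A|)%N.
Proof.
move=> arrA nA Dth gen; set M : 'M[S]_l := \matrix_(i, j) th i 0 j.
have [f Ef] : divides (defpoly A) (\det M).
  by apply: log_der_det => // i; case: (Dth i).
have nQ := defpoly_neq0 arrA.
have key H : H \in A -> exists g, f * g = defpoly (A `\ H)%fset ^+ l.-1.
  move=> HA; have hH := arrA _ HA.
  have Ea := lker_hform hH; set a := hform H in Ea.
  have [i ai] := form_coord (hform_neq0 hH); rewrite -/a in ai.
  set Q' := defpoly (A `\ H)%fset.
  have /fin_all_exists[C EC] : forall m, exists c : 'I_l -> S,
      Q' *: row m (adapted_mx a i) = \sum_j c j *: th j.
    move=> m; apply: gen; rewrite -[A](fsetD1K HA).
    apply: adapted_mx_log_der => //; exact: is_arrangementD1.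
  have EM : Q' *: adapted_mx a i = (\matrix_(m, j) C m j) *m M.
    apply/row_matrixP => m; apply/rowP => q.
    have /rowP/(_ q) := EC m; rewrite !mxE => ->.
    by rewrite summxE; apply: eq_bigr => j _; rewrite !mxE.
  have Ql : defpoly A * Q' ^+ l.-1 = Q' ^+ l * lf a.
    have -> : Q' ^+ l = Q' * Q' ^+ l.-1.
      by rewrite -exprS prednK // (leq_ltn_trans _ (ltn_ord i)).
    by rewrite (defpolyD1 HA) -/a -/Q'; ring.
  move/(congr1 determinant): EM; rewrite detZ det_adapted_mx det_mulmx Ef -Ql.
  move=> E; exists (\det (\matrix_(m, j) C m j)); apply: (mulfI nQ).
  by rewrite E; ring.
(* Otherwise alpha_H would divide a power of Q', to which it is coprime. *)
have cpf H : H \in A -> cop (lf (hform H)) f.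
  move=> HA; have hH := arrA _ HA; apply: cop_form; first exact: hform_neq0.
  move=> [g Eg]; have [k Ek] := key H HA.
  have cp : cop (lf (hform H)) (defpoly (A `\ H)%fset).
    apply: (cop_defpoly (is_arrangementD1 arrA) hH _ (lker_hform hH)).
    by rewrite in_fsetD1 eqxx.
  apply: (@form_ndvd1 _ _ (hform H)); apply: (copX (k := l.-1) cp).
  by rewrite mulr1 -Ek Eg; exists (g * k); ring.
have [H HA] : exists H, H \in A by apply/fset0Pn.
have [g Eg] := key H HA.
(* Here f g alpha_H^(l-1) = Q^(l-1), and Q^(l-1) is coprime to f, so it divides the cofactor of f.
   The quotient t is the inverse of f. *)
have [t Et] : divides (defpoly A ^+ l.-1) (g * lf (hform H) ^+ l.-1).
  apply: (copXl nQ (q := f)).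
    apply: cop_prodl => L LA _; last exact: cpf.
    by rewrite linear_form_eq0; apply/hform_neq0/arrA.
  by exists 1; rewrite mulrA Eg mul1r (defpolyD1 HA) exprMn mulrC.
have ft : t * f = 1.
  apply: (mulIf (expf_neq0 l.-1 nQ)); rewrite mul1r mulrAC -Et mulrAC.
  by rewrite [_ * f]mulrC Eg (defpolyD1 HA) exprMn mulrC.
have hM : \det M \is (\sum_i d i)%N.-homog.
  by apply: det_rows_homog => i; case: (Dth i).
have hQ := defpoly_homog A.
have EQ : defpoly A = t * \det M by rewrite Ef mulrA ft mul1r.
have nM : \det M != 0 by apply: contraNneq nQ => M0; rewrite EQ M0 mulr0.
apply/eqP; rewrite eqn_leq; apply/andP; split.
- apply: (in_degree_diff_ge (homog_partP _ _ t)).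
  apply: contraNneq nQ => t0; move/(congr1 (pihomog mdeg #|` A|)): EQ.
  by rewrite pihomog_dE // (pihomogM _ _ hM) t0 mul0r => ->.
- apply: (in_degree_diff_ge (homog_partP _ _ f)).
  apply: contraNneq nM => f0; move/(congr1 (pihomog mdeg (\sum_i d i)%N)): Ef.
  by rewrite pihomog_dE // (pihomogM _ _ hQ) f0 mul0r => ->.
Qed.

End Saito.

(** * Presentations of D(A) in dimension three *)

Section LinearCombinations.
Context (R : comNzRingType) (n : nat).
Implicit Types (c k u : R) (e x y z : 'rV[R]_n).

(** In these identities e plays the Euler derivation, a the form alpha, and x, y, z generators or
    elements to be expanded in them. *)
Lemma lincomb_shift c0 c1 c2 c3 k1 k2 u1 u2 e x y z :
  c0 *: e + c1 *: (x - k1 *: z - u1 *: e) + c2 *: (y - k2 *: z - u2 *: e)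
    + c3 *: z =
  (c0 - c1 * u1 - c2 * u2) *: e + c1 *: x + c2 *: y
    + (c3 - c1 * k1 - c2 * k2) *: z.
Proof. by apply/rowP => m; rewrite !mxE; ring. Qed.

Lemma lincomb_unshift c0 c1 c2 c3 k1 k2 u1 u2 e x y z :
  c0 *: e + c1 *: x + c2 *: y + c3 *: z =
  (c0 + c1 * u1 + c2 * u2) *: e + c1 *: (x - k1 *: z - u1 *: e)
    + c2 *: (y - k2 *: z - u2 *: e) + (c3 + c1 * k1 + c2 * k2) *: z.
Proof. by apply/rowP => m; rewrite !mxE; ring. Qed.

Lemma lincomb_sub1 k c0 c1 c2 c3 e x y z :
  k *: (c0 *: e + c1 *: x + c2 *: y + c3 *: z) = y ->
  (k * c0) *: e + (k * c1) *: x + (k * c2 - 1) *: y + (k * c3) *: z = 0.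
Proof.
move=> h; transitivity (k *: (c0 *: e + c1 *: x + c2 *: y + c3 *: z) - y).
  by apply/rowP => m; rewrite !mxE; ring.
by rewrite h subrr.
Qed.

Lemma lincomb_del a g c1 c2 u e x y z :
  a *: x = c1 *: e + c2 *: (u *: e + a *: y) + (g * a) *: z ->
  a *: (x - c2 *: y - g *: z) = (c1 + c2 * u) *: e.
Proof.
by move=> h; rewrite !scalerBr h; apply/rowP => m; rewrite !mxE; ring.
Qed.

Lemma lincomb_scale a c1 c2 c3 u e y z :
  c1 *: e + c2 *: y + c3 *: z = 0 ->
  (a * c1 - c2 * u) *: e + c2 *: (u *: e + a *: y) + (a * c3) *: z = 0.
Proof.
move=> h; transitivity (a *: (c1 *: e + c2 *: y + c3 *: z)).
  by apply/rowP => m; rewrite !mxE; ring.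
by rewrite h scaler0.
Qed.

Lemma lincomb_expand a c1 c2 c3 r2 r3 u e x y z :
  r3 *: x - r2 *: y = u *: e + a *: z -> z = c1 *: e + c2 *: x + c3 *: y ->
  (a * c1 + u) *: e + (a * c2 - r3) *: x + (a * c3 + r2) *: y = 0.
Proof.
move=> h hz; transitivity (u *: e + a *: (c1 *: e + c2 *: x + c3 *: y)
    - (r3 *: x - r2 *: y)).
  by apply/rowP => m; rewrite !mxE; ring.
by rewrite -hz h subrr.
Qed.

Lemma lincomb_relation a g r2 r3 u c0 c1 c2 e x y z :
  r3 *: x - r2 *: y = u *: e + a *: z ->
  c0 *: e + c1 *: x + c2 *: y + (g * a) *: z =
  (c0 - g * u) *: e + (c1 + g * r3) *: x + (c2 - g * r2) *: y.
Proof.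
move=> h; transitivity (c0 *: e + c1 *: x + c2 *: y
    + g *: (r3 *: x - r2 *: y - u *: e)).
  by rewrite h [_ + a *: z]addrC addrK scalerA.
by apply/rowP => m; rewrite !mxE; ring.
Qed.

Lemma lincomb_add_gen a u c1 c2 c3 k e x y z :
  u *: e + a *: (c1 *: e + c2 *: x + c3 *: y) + k *: z =
  (u + a * c1) *: e + c2 *: (a *: x) + c3 *: (a *: y) + k *: z.
Proof. by apply/rowP => m; rewrite !mxE; ring. Qed.

Lemma lincomb_add_rel a c0 c1 c2 c3 t2 t3 e x y :
  c0 *: e + c1 *: (a *: x) + c2 *: (a *: y) + c3 *: (t3 *: x - t2 *: y) =
  c0 *: e + (c1 * a + c3 * t3) *: x + (c2 * a - c3 * t2) *: y.
Proof. by apply/rowP => m; rewrite !mxE; ring. Qed.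

(** As k is invertible, the relation expresses f3 z through e, x, y, so z is eliminated from every
    combination whose last coefficient is a multiple of f3. *)
Lemma lincomb_elim k k' c0 c1 c2 f0 f1 f2 f3 g e x y z :
  k' * k = 1 -> f0 *: e + f1 *: x + f2 *: y + (k * f3) *: z = 0 ->
  c0 *: e + c1 *: x + c2 *: y + (g * f3) *: z =
  (c0 - g * k' * f0) *: e + (c1 - g * k' * f1) *: x + (c2 - g * k' * f2) *: y.
Proof.
move=> kk h; transitivity (c0 *: e + c1 *: x + c2 *: y + (g * f3) *: z
    - (g * k') *: (f0 *: e + f1 *: x + f2 *: y + (k * f3) *: z)).
  by rewrite h scaler0 subr0.
have -> : g * f3 = g * (k' * k) * f3 by rewrite kk mulr1.
by apply/rowP => m; rewrite !mxE; ring.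
Qed.

Lemma lincomb_shift3 c c1 c2 c3 x y z :
  c1 *: x + c2 *: y + c3 *: (z - c *: y) = c1 *: x + (c2 - c3 * c) *: y + c3 *: z.
Proof. by apply/rowP => m; rewrite !mxE; ring. Qed.

Lemma lincomb_divide a g c0 c1 c2 e x y z w :
  a *: x = c0 *: e + c1 *: (a *: y) + c2 *: (a *: z) + (g * a) *: w ->
  a *: (x - g *: w - c2 *: z - c1 *: y) = c0 *: e.
Proof.
by move=> h; rewrite !scalerBr h; apply/rowP => m; rewrite !mxE; ring.
Qed.

Lemma lincomb_scale3 a c0 c1 c2 e y z w : c0 *: e + c1 *: y + c2 *: z = 0 ->
  (a * c0) *: e + c1 *: (a *: y) + c2 *: (a *: z) + 0 *: w = 0.
Proof.
move=> h; transitivity (a *: (c0 *: e + c1 *: y + c2 *: z)).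
  by apply/rowP => m; rewrite !mxE; ring.
by rewrite h scaler0.
Qed.

End LinearCombinations.

Section Presentations.
Context (K : fieldType).
Local Notation V := 'rV[K]_3.
Local Notation S := {mpoly K[3]}.
Local Notation Der := 'rV[S]_3.
Local Notation lf := (@linear_form K 3).
Local Notation E := (euler K 3).
Local Notation ord3_1 := (lift (@ord0 2) (@ord0 1)).
Local Notation ord3_2 := (lift (@ord0 2) (lift (@ord0 1) (@ord0 0))).
Implicit Types (p q c : S) (th et ph : Der).
Implicit Types (A : {fset {vspace V}}) (H L : {vspace V}).

Lemma forall_ord3 (P : 'I_3 -> Prop) : P ord0 -> P ord3_1 -> P ord3_2 -> forall i, P i.
Proof.
by move=> P0 P1 P2 i; case: (unliftP ord0 i) => [m ->|->] //;
  case: (unliftP ord0 m) => [n ->|->] //; rewrite (ord1 n).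
Qed.

Lemma sum_ord3E (M : nmodType) (F : 'I_3 -> M) :
  \sum_i F i = F ord0 + F ord3_1 + F ord3_2.
Proof. by rewrite !big_ord_recl big_ord0 /= addr0 addrA. Qed.

Definition ord3_fun (T : Type) (x y z : T) : 'I_3 -> T := tnth [tuple x; y; z].

Definition free_basis A (d1 d2 d3 : nat) th1 th2 th3 : Prop :=
  [/\ [/\ log_der A th1, log_der A th2 & log_der A th3],
      [/\ der_homog d1 th1, der_homog d2 th2 & der_homog d3 th3],
      forall et, log_der A et -> exists c1 c2 c3 : S,
        et = c1 *: th1 + c2 *: th2 + c3 *: th3
    & forall c1 c2 c3 : S, c1 *: th1 + c2 *: th2 + c3 *: th3 = 0 ->
        [/\ c1 = 0, c2 = 0 & c3 = 0]].

Lemma free_basisP A d1 d2 d3 : free_with_exp A [tuple d1; d2; d3] <->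
  exists th1 th2 th3, free_basis A d1 d2 d3 th1 th2 th3.
Proof.
split=> [[th [D gen ind]]|[th1 [th2 [th3 [[D1 D2 D3] [h1 h2 h3] gen ind]]]]].
  exists (th ord0), (th ord3_1), (th ord3_2); split.
  - by split; case: (D ord0) (D ord3_1) (D ord3_2) => [? _] [? _] [? _].
  - by split; case: (D ord0) (D ord3_1) (D ord3_2) => [_ ?] [_ ?] [_ ?].
  - move=> et /gen[c ->]; exists (c ord0), (c ord3_1), (c ord3_2).
    exact: sum_ord3E.
  - move=> c1 c2 c3 e; have := ind (ord3_fun c1 c2 c3).
    rewrite sum_ord3E => /(_ e) h.
    by split; [have := h ord0|have := h ord3_1|have := h ord3_2].
exists (ord3_fun th1 th2 th3); split.
- by apply: forall_ord3.
- move=> et /gen[c1 [c2 [c3 ->]]]; exists (ord3_fun c1 c2 c3).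
  by rewrite sum_ord3E.
- move=> c; rewrite sum_ord3E => /ind[e0 e1 e2].
  by apply: forall_ord3.
Qed.

Lemma free_basis_swap23 A d1 d2 d3 th1 th2 th3 :
  free_basis A d1 d2 d3 th1 th2 th3 -> free_basis A d1 d3 d2 th1 th3 th2.
Proof.
move=> [[D1 D2 D3] [h1 h2 h3] gen ind]; split=> //.
  by move=> et /gen[c1 [c2 [c3 ->]]]; exists c1, c3, c2; rewrite addrAC.
by move=> c1 c2 c3; rewrite addrAC => /ind[].
Qed.

Lemma free_basis_swap12 A d1 d2 d3 th1 th2 th3 :
  free_basis A d1 d2 d3 th1 th2 th3 -> free_basis A d2 d1 d3 th2 th1 th3.
Proof.
move=> [[D1 D2 D3] [h1 h2 h3] gen ind]; split=> //.
  by move=> et /gen[c1 [c2 [c3 ->]]]; exists c2, c1, c3; rewrite [_ + c1 *: _]addrC.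
by move=> c1 c2 c3; rewrite [_ + c2 *: _]addrC => /ind[].
Qed.

Lemma free_with_exp_swap A d1 d2 d3 :
  free_with_exp A [tuple d1; d2; d3] -> free_with_exp A [tuple d1; d3; d2].
Proof.
move=> /free_basisP[th1 [th2 [th3 /free_basis_swap23 B]]].
by apply/free_basisP; exists th1, th3, th2.
Qed.

Lemma free_basis_degree A d1 d2 d3 th1 th2 th3 : is_arrangement A ->
  A != fset0 -> free_basis A d1 d2 d3 th1 th2 th3 -> (d1 + d2 + d3 = #|` A|)%N.
Proof.
move=> arrA nA [[D1 D2 D3] [h1 h2 h3] gen _].
have := @saito_degree K 3 A (ord3_fun d1 d2 d3) (ord3_fun th1 th2 th3) arrA nA.
rewrite !big_ord_recl big_ord0 /= addn0 addnA; apply.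
  by apply: forall_ord3.
by move=> et /gen[c1 [c2 [c3 ->]]]; exists (ord3_fun c1 c2 c3); rewrite sum_ord3E.
Qed.

Lemma free_basis_replace A d1 d2 d3 th1 th2 th3 et (k : K) c2 c3 :
  free_basis A d1 d2 d3 th1 th2 th3 -> k != 0 -> log_der A et -> der_homog d1 et ->
  et = k%:MP *: th1 + c2 *: th2 + c3 *: th3 -> free_basis A d1 d2 d3 et th2 th3.
Proof.
move=> [[D1 D2 D3] [h1 h2 h3] gen ind] k0 De he Ee.
have kV : k^-1%:MP * k%:MP = 1 :> S by rewrite -mpolyCM mulVf.
split=> //.
  move=> x /gen[x1 [x2 [x3 ->]]].
  exists (x1 * k^-1%:MP), (x2 - x1 * k^-1%:MP * c2), (x3 - x1 * k^-1%:MP * c3).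
  apply/rowP => m; rewrite Ee !mxE -[x1 in LHS]mulr1 -kV; ring.
move=> x1 x2 x3; rewrite Ee => e.
have [] := ind (x1 * k%:MP) (x2 + x1 * c2) (x3 + x1 * c3).
  rewrite -[RHS]e; apply/rowP => m; rewrite !mxE; ring.
move=> e1 e2 e3; have x10 : x1 = 0 by rewrite -[x1]mulr1 -kV mulrCA e1 mulr0.
by split=> //; [move: e2|move: e3]; rewrite x10 mul0r addr0.
Qed.

Lemma free_basis_shift A d1 d2 d3 th1 th2 th3 c :
  free_basis A d1 d2 d3 th1 th2 th3 -> in_degree_diff c d3 d2 ->
  free_basis A d1 d2 d3 th1 th2 (th3 - c *: th2).
Proof.
move=> [[D1 D2 D3] [h1 h2 h3] gen ind] hc; split.
- by split=> //; apply/log_derB/log_derZ.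
- by split=> //; apply: der_homogB => //; apply: der_homogZ hc h2.
- move=> et /gen[c1 [c2 [c3 ->]]]; exists c1, (c2 + c3 * c), c3.
  by rewrite lincomb_shift3 addrK.
- move=> c1 c2 c3; rewrite lincomb_shift3 => /ind[-> e e3]; split=> //.
  by move: e; rewrite e3 mul0r subr0.
Qed.

Lemma homog_coeff0_neq0 d p : p \is d.-homog -> p@_0%MM != 0 -> d = 0%N.
Proof. by case: d => // d hp; rewrite (homog_coeff0 hp) // eqxx. Qed.

(** Write E as the sum of c_i th_i and th_i(alpha_H) = g_i alpha_H. Evaluating at alpha_H gives 1 as
    the sum of the c_i g_i, so some c_i g_i has a nonzero constant term. Their degrees 1 - d_i and
    d_i - 1 then force d_i = 1 and c_i constant, and E can replace th_i. *)
Lemma free_basis_euler A a b : is_arrangement A -> A != fset0 ->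
  free_with_exp A [tuple 1%N; a; b] ->
  exists th2 th3, free_basis A 1 a b E th2 th3.
Proof.
move=> arrA /fset0Pn[H HA] /free_basisP[th1 [th2 [th3 B]]].
have [[D1 D2 D3] [h1 h2 h3] gen ind] := B.
have [x1 [x2 [x3 EE]]] := gen _ (@log_der_euler K 3 A).
pose c1 := homog_part 1 1 x1; pose c2 := homog_part 1 a x2.
pose c3 := homog_part 1 b x3.
have {}EE : E = c1 *: th1 + c2 *: th2 + c3 *: th3.
  rewrite -{1}(der_part_id (@euler_homog K 3)) EE !der_partD.
  by rewrite (der_partZ _ _ h1) (der_partZ _ _ h2) (der_partZ _ _ h3).
have step d th c : der_homog d th -> log_der A th -> in_degree_diff c 1 d ->
    exists g, der_app th (lf (hform H)) = g * lf (hform H) /\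
      ((c * g)@_0%MM != 0 -> d = 1%N /\ exists2 k : K, k != 0 & c = k%:MP).
  move=> hd D hc; have [g Eg] := D H HA _ (lker_hform (arrA _ HA)).
  pose g' := homog_part d 1 g; exists g'; split.
    rewrite -(pihomog_dE (der_app_homog (hform H) hd)) Eg.
    exact/pihomogM/linear_form_homog.
  rewrite coeff0M mulf_eq0 negb_or => /andP[c0 g0].
  have d1 : d = 1%N.
    have := homog_partP d 1 g; rewrite -/g' /in_degree_diff.
    case: ltnP => [_ g'0|d0 hg]; first by rewrite g'0 mcoeff0 eqxx in g0.
    by have := homog_coeff0_neq0 hg g0; lia.
  split=> //; exists c@_0%MM => //; apply: homog0_const.
  by move: hc; rewrite d1.
have [g1 [Eg1 k1]] := step _ _ _ h1 D1 (homog_partP _ _ x1).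
have [g2 [Eg2 k2]] := step _ _ _ h2 D2 (homog_partP _ _ x2).
have [g3 [Eg3 k3]] := step _ _ _ h3 D3 (homog_partP _ _ x3).
rewrite -/c1 in k1; rewrite -/c2 in k2; rewrite -/c3 in k3.
have l0 : lf (hform H) != 0 by rewrite linear_form_eq0; apply/hform_neq0/arrA.
have one : 1 = c1 * g1 + c2 * g2 + c3 * g3.
  apply: (mulIf l0); rewrite mul1r -{1}(der_app_euler (hform H)) EE.
  by rewrite !der_appD !der_appZ Eg1 Eg2 Eg3; ring.
have DE := @log_der_euler K 3 A; have hE := @euler_homog K 3.
have [n1|z1] := boolP ((c1 * g1)@_0%MM != 0).
  have [_ [k nk Ek]] := k1 n1; exists th2, th3.
  by apply: (free_basis_replace B nk DE hE (c2 := c2) (c3 := c3)); rewrite -Ek.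
(* The replaced generator has degree a = 1, so [th1] takes over the exponent a. *)
have [n2|z2] := boolP ((c2 * g2)@_0%MM != 0).
  have [a1 [k nk Ek]] := k2 n2; subst a; exists th1, th3.
  apply: (free_basis_replace (free_basis_swap12 B) nk DE hE (c2 := c1) (c3 := c3)).
  by rewrite -Ek EE [c1 *: _ + _]addrC.
have [n3|z3] := boolP ((c3 * g3)@_0%MM != 0).
  have [b1 [k nk Ek]] := k3 n3; subst b; exists th2, th1.
  apply: (free_basis_replace (free_basis_swap12 (free_basis_swap23
    (free_basis_swap12 B))) nk DE hE (c2 := c2) (c3 := c1)).
  by rewrite -Ek EE addrC [c1 *: _ + _]addrC addrA.
move/(congr1 (mcoeff 0%MM)): one; rewrite !raddfD /= mcoeff1 eqxx.
rewrite (eqP (negbNE z1)) (eqP (negbNE z2)) (eqP (negbNE z3)) !addr0.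
by move/eqP; rewrite oner_eq0.
Qed.

(* The ungraded content of plus-one generatedness. It does not single out the
   generator whose coefficient is a linear form, so that the generators other
   than the Euler derivation can be permuted. *)
Definition one_relation A et1 et2 et3 (f0 f1 f2 f3 : S) : Prop :=
  [/\ [/\ log_der A et1, log_der A et2 & log_der A et3],
      forall et, log_der A et -> exists c0 c1 c2 c3 : S,
        et = c0 *: E + c1 *: et1 + c2 *: et2 + c3 *: et3,
      forall c0 c1 c2 c3 : S,
        c0 *: E + c1 *: et1 + c2 *: et2 + c3 *: et3 = 0 <->
        exists g, [/\ c0 = g * f0, c1 = g * f1, c2 = g * f2 & c3 = g * f3],
      [/\ f0@_0%MM = 0, f1@_0%MM = 0, f2@_0%MM = 0 & f3@_0%MM = 0]
    & ~ [/\ f0 = 0, f1 = 0, f2 = 0 & f3 = 0]].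

Lemma one_relation_swap12 A et1 et2 et3 f0 f1 f2 f3 :
  one_relation A et1 et2 et3 f0 f1 f2 f3 -> one_relation A et2 et1 et3 f0 f2 f1 f3.
Proof.
move=> [[D1 D2 D3] gen syz [z0 z1 z2 z3] nz]; split=> //.
- move=> et /gen[c0 [c1 [c2 [c3 ->]]]]; exists c0, c2, c1, c3.
  by rewrite [c0 *: _ + _ + _]addrAC.
- move=> c0 c1 c2 c3; rewrite [c0 *: _ + _ + _]addrAC; split.
    by move/syz => [g [? ? ? ?]]; exists g.
  by move=> [g [? ? ? ?]]; apply/syz; exists g.
- by move=> [? ? ? ?]; apply: nz.
Qed.

Lemma one_relation_swap23 A et1 et2 et3 f0 f1 f2 f3 :
  one_relation A et1 et2 et3 f0 f1 f2 f3 -> one_relation A et1 et3 et2 f0 f1 f3 f2.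
Proof.
move=> [[D1 D2 D3] gen syz [z0 z1 z2 z3] nz]; split=> //.
- by move=> et /gen[c0 [c1 [c2 [c3 ->]]]]; exists c0, c1, c3, c2; rewrite [in RHS]addrAC.
- move=> c0 c1 c2 c3; rewrite addrAC; split.
    by move/syz => [g [? ? ? ?]]; exists g.
  by move=> [g [? ? ? ?]]; apply/syz; exists g.
- by move=> [? ? ? ?]; apply: nz.
Qed.

(** A unitriangular change of generators: what is subtracted from [et1] and [et2] is returned to the
    coefficients of E and [et3]. *)
Lemma one_relation_shift A et1 et2 et3 f0 f1 f2 f3 (u1 u2 k1 k2 : S) :
  one_relation A et1 et2 et3 f0 f1 f2 f3 ->
  one_relation A (et1 - k1 *: et3 - u1 *: E) (et2 - k2 *: et3 - u2 *: E) et3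
    (f0 + u1 * f1 + u2 * f2) f1 f2 (f3 + k1 * f1 + k2 * f2).
Proof.
move=> [[D1 D2 D3] gen syz [z0 z1 z2 z3] nz].
have DE := @log_der_euler K 3 A.
split.
- by split=> //; apply: log_derB; rewrite ?log_derB //; try exact: log_derZ;
     apply: log_derB => //; apply: log_derZ.
- move=> et /gen[c0 [c1 [c2 [c3 ->]]]].
  exists (c0 + c1 * u1 + c2 * u2), c1, c2, (c3 + c1 * k1 + c2 * k2).
  exact: lincomb_unshift.
- move=> c0 c1 c2 c3; rewrite lincomb_shift; split.
    move/syz => [g [e0 e1 e2 e3]]; exists g; split=> //.
      have -> : c0 = c0 - c1 * u1 - c2 * u2 + c1 * u1 + c2 * u2 by ring.
      by rewrite e0 e1 e2; ring.
    have -> : c3 = c3 - c1 * k1 - c2 * k2 + c1 * k1 + c2 * k2 by ring.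
    by rewrite e3 e1 e2; ring.
  move=> [g [e0 e1 e2 e3]]; apply/syz; exists g; split=> //.
    by rewrite e0 e1 e2; ring.
  by rewrite e3 e1 e2; ring.
- by split; rewrite // !raddfD /= !coeff0M ?z0 ?z1 ?z2 ?z3 !mulr0 !addr0.
move=> [e0 e1 e2 e3]; apply: nz; split=> //.
  by rewrite -e0 e1 e2; ring.
by rewrite -e3 e1 e2; ring.
Qed.

(* A relation not involving [et3] would exhibit the normalised [et1] and [et2],
   which are then proportional, as multiples of one element of D(A), with
   coefficients in the irrelevant ideal. *)
Lemma one_relation_neq0 A et1 et2 et3 f0 f1 f2 f3 :
  is_arrangement A -> A != fset0 -> one_relation A et1 et2 et3 f0 f1 f2 f3 -> f3 != 0.
Proof.
move=> arrA /fset0Pn[H HA] pres; apply/eqP => f30.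
have [[D1 D2 D3] _ _ _ _] := pres.
have hH := lker_hform (arrA _ HA).
have l0 : lf (hform H) != 0 by rewrite linear_form_eq0; apply/hform_neq0/arrA.
have [g1 Eg1] := D1 H HA _ hH; have [g2 Eg2] := D2 H HA _ hH.
(* After this normalisation x and y kill alpha_H, so evaluating the relation at alpha_H shows that E
   does not occur in it. *)
have := one_relation_shift g1 g2 0 0 pres.
rewrite !scale0r !subr0 !mul0r !addr0 f30.
set x := et1 - _; set y := et2 - _; set f0' := f0 + _ + _.
have x0 : der_app x (lf (hform H)) = 0.
  by rewrite der_appB der_appZ der_app_euler Eg1 subrr.
have y0 : der_app y (lf (hform H)) = 0.
  by rewrite der_appB der_appZ der_app_euler Eg2 subrr.
clearbody x y f0'.
move=> [[Dx Dy _] gen syz [z0 z1 z2 _] nz] {pres}.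
have rel : f0' *: E + f1 *: x + f2 *: y = 0.
  have := (syz f0' f1 f2 0).2; rewrite scale0r addr0; apply.
  by exists 1; rewrite !mul1r.
have f0'0 : f0' = 0.
  apply: (mulIf l0); rewrite mul0r.
  have := congr1 (fun t => der_app t (lf (hform H))) rel.
  rewrite !der_appD !der_appZ x0 y0 der_app_euler !mulr0 !addr0 => ->.
  by rewrite /der_app big1 // => m _; rewrite mxE mul0r.
have syz' c1 c2 : c1 *: x + c2 *: y = 0 -> exists g, c1 = g * f1 /\ c2 = g * f2.
  move=> e; have [|g [_ e1 e2 _]] := (syz 0 c1 c2 0).1; last by exists g.
  by rewrite !scale0r add0r addr0.
move: rel; rewrite f0'0 scale0r add0r => rel.
have relm m : f1 * x 0 m = - (f2 * y 0 m).
  by apply/eqP; rewrite -addr_eq0; move/rowP/(_ m): rel; rewrite !mxE => ->.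
have minor (m r : 'I_3) : y 0 m * x 0 r = x 0 m * y 0 r.
  have [f10|f10] := eqVneq f1 0.
    have f20 : f2 != 0 by apply/eqP => f20; apply: nz; rewrite f0'0.
    have yz s : y 0 s = 0.
      apply/eqP; have := relm s; rewrite f10 mul0r => /esym/eqP.
      by rewrite oppr_eq0 mulf_eq0 (negbTE f20).
    by rewrite !yz mul0r mulr0.
  by apply: (mulfI f10); rewrite mulrCA relm [RHS]mulrA relm; ring.
(* As x and y are proportional, y_m x - x_m y = 0 is a relation, hence a multiple of (f1, f2). The
   multipliers k_m are the coefficients of the common divisor [th] of x and y. *)
have /fin_all_exists[k Ek] : forall m, exists g, x 0 m = - (g * f2) /\ y 0 m = g * f1.
  move=> m; have [|g [e1 e2]] := syz' (y 0 m) (- x 0 m).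
    by apply/rowP => q; rewrite !mxE minor; ring.
  by exists g; rewrite -e1 -e2 opprK.
pose th : Der := \row_m k m.
have Ex : x = (- f2) *: th by apply/rowP => m; rewrite !mxE (Ek m).1; ring.
have Ey : y = f1 *: th by apply/rowP => m; rewrite !mxE (Ek m).2; ring.
(* If alpha_L did not divide th(alpha_L), it would divide f1 and f2. The quotients again form a
   relation, hence a multiple of (f1, f2), and alpha_L would be a unit. *)
have Dth : log_der A th.
  apply/log_derP => // L LA; have hL := arrA _ LA.
  have a0 := hform_neq0 hL; have Ea := lker_hform hL.
  have := Dx L LA _ Ea; rewrite Ex der_appZ => /(form_prime a0)[dv2|//].
  have := Dy L LA _ Ea; rewrite Ey der_appZ => /(form_prime a0)[[h1 E1]|//].
  have [h2 E2] : divides (lf (hform L)) f2 by rewrite -[f2]opprK; apply: dividesN.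
  have nl : lf (hform L) != 0 by rewrite linear_form_eq0.
  have [|g [e1 e2]] := syz' h1 h2.
    apply/rowP => m; apply: (mulfI nl); rewrite !mxE mulr0 Ex Ey !mxE E1 E2; ring.
  exfalso; apply: (@form_ndvd1 _ _ (hform L)); exists g.
  have [f10|f10] := eqVneq f1 0; last first.
    by apply: (mulIf f10); rewrite mul1r mulrAC -e1 -E1.
  have f20 : f2 != 0 by apply/eqP => f20; apply: nz; rewrite f0'0.
  by apply: (mulIf f20); rewrite mul1r mulrAC -e2 -E2.
(* Expanding [th] in y = f1 [th] gives a relation whose coefficient at y has constant term -1,
   against minimality. *)
have [c0 [c1 [c2 [c3 Eth]]]] := gen _ Dth.
have [|g [_ _ e2 _]] := (syz (f1 * c0) (f1 * c1) (f1 * c2 - 1) (f1 * c3)).1.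
  by apply: lincomb_sub1; rewrite -Eth.
move/(congr1 (mcoeff 0%MM)): e2.
rewrite raddfB /= !coeff0M z1 z2 mul0r mulr0 mcoeff1 eqxx sub0r => /eqP.
by rewrite oppr_eq0 oner_eq0.
Qed.

Lemma one_relation_plus_one_generated A et1 et2 et3 f0 f1 f2 (a : 'Hom(V, K^o))
    (strict : bool) d e lev :
  one_relation A et1 et2 et3 f0 f1 f2 (lf a) -> a != 0 ->
  der_homog d et1 -> der_homog e et2 -> der_homog lev et3 ->
  in_degree_diff f0 lev.+1 1 -> in_degree_diff f1 lev.+1 d ->
  in_degree_diff f2 lev.+1 e ->
  plus_one_generated strict A [tuple 1%N; d; e] lev.
Proof.
move=> [[D1 D2 D3] gen syz [z0 z1 z2 z3] nz] a0 h1 h2 h3 hf0 hf1 hf2.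
have DE := @log_der_euler K 3 A; have hE := @euler_homog K 3.
have al0 : lf a != 0 by rewrite linear_form_eq0.
exists (ord3_fun E et1 et2), et3, (ord3_fun f0 f1 f2), a; split=> //.
- by split=> //; apply: forall_ord3.
- move=> et /gen[c0 [c1 [c2 [c3 ->]]]].
  by exists (ord3_fun c0 c1 c2), c3; rewrite sum_ord3E.
- by apply: forall_ord3.
split=> //.
- by move=> g _ /eqP; rewrite mulf_eq0 (negbTE al0) orbF => /eqP.
- move=> c c3; rewrite sum_ord3E; split.
    move=> /syz[g [e0 e1 e2 e3]]; exists g; split=> //.
    by apply: forall_ord3.
  move=> [g [ec e3]]; apply/syz; exists g.
  by split; [exact: (ec ord0)|exact: (ec ord3_1)|exact: (ec ord3_2)|].
Qed.

Lemma plus_one_generated_one_relation A (strict : bool) d1 d e lev :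
  plus_one_generated strict A [tuple d1; d; e] lev ->
  exists et1 et2 et3 f0 f1 f2 f3,
    [/\ one_relation A et1 et2 et3 f0 f1 f2 f3,
        [/\ der_homog d et1, der_homog e et2 & der_homog lev et3],
        in_degree_diff f1 lev.+1 d, in_degree_diff f2 lev.+1 e &
        f3 \is 1.-homog].
Proof.
move=> [th [ph [f [a [E0 [D [Dph hph]] gen hf [inj syz _]]]]]].
exists (th ord3_1), (th ord3_2), ph, (f ord0), (f ord3_1), (f ord3_2), (lf a).
split.
- split.
  + by split=> //; [exact: (D ord3_1).1|exact: (D ord3_2).1].
  + move=> et /gen[c [c3 ->]]; exists (c ord0), (c ord3_1), (c ord3_2), c3.
    by rewrite sum_ord3E E0.
  + move=> c0 c1 c2 c3; have := syz (ord3_fun c0 c1 c2) c3.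
    rewrite sum_ord3E E0 => -[s1 s2]; split.
      move=> /s1[g [ec e3]]; exists g.
      by split; [exact: (ec ord0)|exact: (ec ord3_1)|exact: (ec ord3_2)|].
    move=> [g [e0 e1 e2 e3]]; apply: s2; exists g; split=> //.
    exact: forall_ord3.
  + split; [exact: (hf _).2|exact: (hf _).2|exact: (hf _).2|].
    exact: (homog_coeff0 (linear_form_homog a)).
  (* If all coefficients vanished, the first map of the resolution would kill 1. *)
  + move=> [e0 e1 e2 e3]; have := oner_neq0 S; rewrite (inj 1) ?eqxx //.
      by apply: forall_ord3; rewrite ?e0 ?e1 ?e2 mulr0.
    by rewrite e3 mulr0.
- by split; [exact: (D ord3_1).2|exact: (D ord3_2).2|].
- exact: (hf ord3_1).1.
- exact: (hf ord3_2).1.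
- exact: linear_form_homog.
Qed.

(** A nonzero homogeneous coefficient without constant term has positive degree lev + 1 - d. *)
Lemma relation_degree d lev (f : S) : in_degree_diff f lev.+1 d -> f@_0%MM = 0 ->
  f != 0 -> (d <= lev)%N.
Proof.
move=> hf f0 nf; have := in_degree_diff_ge hf nf; rewrite leq_eqVlt => /orP[/eqP ed|//].
have := in_degree_diff_homog hf; rewrite ed subnn => /homog0_const Ef.
by move: nf; rewrite Ef f0 mpolyC0 eqxx.
Qed.

Lemma homog1_multiple (a : 'Hom(V, K^o)) (f : S) : divides (lf a) f -> f \is 1.-homog -> f != 0 ->
  exists2 k : K, k != 0 & f = k%:MP * lf a.
Proof.
move=> [g Eg] hf nf; have := pihomogM 1 g (linear_form_homog a).
rewrite -Eg pihomog_dE // => Ef; have := homog_partP 1 1 g.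
rewrite /in_degree_diff /= => /homog0_const Ec.
exists (homog_part 1 1 g)@_0%MM; last by rewrite -Ec.
by apply: contraNneq nf => k0; rewrite Ef Ec k0 mpolyC0 mul0r.
Qed.

End Presentations.

(** * Adding and deleting a plane *)

Section AdditionDeletion.
Context (K : fieldType).
Local Notation V := 'rV[K]_3.
Local Notation S := {mpoly K[3]}.
Local Notation Der := 'rV[S]_3.
Local Notation lf := (@linear_form K 3).
Local Notation E := (euler K 3).
Context (A : {fset {vspace V}}) (H : {vspace V}) (a : 'Hom(V, K^o)).
Context (i j k : 'I_3).
Hypotheses (arrA : is_arrangement A) (nA : A != fset0).
Hypotheses (hH : is_hyperplane H) (HA : H \notin A).
Hypotheses (Ea : lker a = H) (ai : a (delta_mx 0 i) != 0).
Hypotheses (ij : i != j) (ik : i != k) (jk : j != k).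
Implicit Types (p q r s t c : S) (th et psi x y : Der) (d e : nat).

Local Notation A1 := (H |` A)%fset.
Local Notation R := [fset (L :&: H)%VS | L in A]%fset.
Local Notation n := #|` A|.
Local Notation h := #|` R|.
Local Notation al := (lf a).
Local Notation pr := (proj_subst a (normal_vec a i)).

Let av : a (normal_vec a i) = 1 := normal_vecP ai.
Let a0 : a != 0 := hyperplane_form_neq0 hH Ea.
Let al0 : al != 0. Proof. by rewrite linear_form_eq0. Qed.
Let pr_al : pr al = 0.
Proof. by rewrite proj_subst_form av scale1r subrr linear_form0. Qed.
Let DE B : log_der B E := @log_der_euler K 3 B.
Let hE : der_homog 1 E := @euler_homog K 3.

(* [t] represents T(th), and below [r] represents R(th), for the maps T and R
   of the introductory comment. *)
Definition is_trace th t : Prop :=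
  pr (der_app th al) = pr t * pr (trace_poly A H).

Definition is_minor th r : Prop :=
  pr (euler_minor j k th) = pr r * restriction_poly A H a i.

Lemma proj_eq0_multiple p : pr p = 0 -> exists g, p = g * al.
Proof. by move/(proj_subst_eq0 _ av). Qed.

Lemma projM p q : pr (p * q) = pr p * pr q. Proof. exact: rmorphM. Qed.

Lemma log_der_A1 th : log_der A1 th <-> log_der A th /\ pr (der_app th al) = 0.
Proof.
split=> [/(log_der_fset1U _ _ Ea hH)[D /(proj_subst_eq0 _ av)]|[D]] //.
by move/(proj_subst_eq0 _ av) => dv; apply/(log_der_fset1U _ _ Ea hH).
Qed.

Lemma log_der_A1_A th : log_der A1 th -> log_der A th.
Proof. by case/log_der_A1. Qed.

Lemma log_der_al th : log_der A th -> log_der A1 (al *: th).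
Proof.
move=> D; apply/log_der_A1; split; first exact: log_derZ.
by rewrite der_appZ projM pr_al mul0r.
Qed.

Lemma is_traceD th et s t : is_trace th s -> is_trace et t ->
  is_trace (th + et) (s + t).
Proof. by rewrite /is_trace der_appD !rmorphD /= mulrDl => -> ->. Qed.

Lemma is_traceZ c th s : is_trace th s -> is_trace (c *: th) (c * s).
Proof. by rewrite /is_trace der_appZ !projM -mulrA => ->. Qed.

Lemma is_traceB th et s t : is_trace th s -> is_trace et t ->
  is_trace (th - et) (s - t).
Proof. by rewrite /is_trace der_appB !rmorphB /= mulrBl => -> ->. Qed.

Lemma is_trace0 th : log_der A1 th -> is_trace th 0.
Proof. by case/log_der_A1 => _; rewrite /is_trace rmorph0 mul0r. Qed.

Lemma is_trace_uniq th s t : is_trace th s -> is_trace th t -> pr s = pr t.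
Proof.
rewrite /is_trace => -> /mulIf; apply; exact: (proj_trace_poly_neq0 _ arrA HA Ea).
Qed.

Lemma is_trace_eq0 th t : log_der A th -> is_trace th t -> pr t = 0 ->
  log_der A1 th.
Proof. by move=> D T t0; apply/log_der_A1; split=> //; rewrite T t0 mul0r. Qed.

Lemma trace_ex th : log_der A th -> exists t, is_trace th t.
Proof. exact: trace_exists. Qed.

Lemma trace_ex_homog d th : log_der A th -> der_homog d th ->
  exists2 t, is_trace th t & in_degree_diff t d (n - h).
Proof. exact: trace_exists_homog. Qed.

(** The witness is Q(A) times the constant derivation along [normal_vec]; its value at alpha is
    Q(A), which alpha does not divide. *)
Lemma trace_nontrivial : exists th t, [/\ log_der A th, is_trace th t & pr t != 0].
Proof.
pose th : Der :=
  defpoly A *: ((a (delta_mx 0 i) : K)^-1%:MP *: delta_mx 0 i).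
have D : log_der A th by apply: log_der_defpoly.
have [t T] := trace_ex D; exists th, t; split=> //.
apply/eqP => t0; have /log_der_A1[_] := is_trace_eq0 D T t0.
rewrite !der_appZ der_app_delta -mpolyCM mulVf // mulr1.
by move/(proj_subst_eq0 _ av); apply: (defpoly_ndvd arrA hH HA Ea).
Qed.

Lemma is_minorD th et s t : is_minor th s -> is_minor et t ->
  is_minor (th + et) (s + t).
Proof. by rewrite /is_minor euler_minorD !rmorphD /= mulrDl => -> ->. Qed.

Lemma is_minorZ c th s : is_minor th s -> is_minor (c *: th) (c * s).
Proof. by rewrite /is_minor euler_minorZ !projM -mulrA => ->. Qed.

Lemma is_minorB th et s t : is_minor th s -> is_minor et t ->
  is_minor (th - et) (s - t).
Proof. by rewrite /is_minor euler_minorB !rmorphB /= mulrBl => -> ->. Qed.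

Lemma is_minorE : is_minor E 0.
Proof. by rewrite /is_minor euler_minor_euler !rmorph0 mul0r. Qed.

Lemma is_minor_al th : is_minor (al *: th) 0.
Proof. by rewrite /is_minor euler_minorZ projM pr_al rmorph0 !mul0r. Qed.

Lemma is_minor_uniq th s t : is_minor th s -> is_minor th t -> pr s = pr t.
Proof.
rewrite /is_minor => -> /mulIf; apply; exact: (restriction_poly_neq0 _ arrA HA Ea).
Qed.

Lemma minor_ex th : log_der A1 th -> exists r, is_minor th r.
Proof. exact: (euler_minor_exists arrA hH HA Ea ai ij ik jk). Qed.

Lemma minor_ex_homog d th : log_der A1 th -> der_homog d th ->
  exists2 r, is_minor th r & in_degree_diff r d.+1 h.
Proof. exact: (euler_minor_exists_homog arrA hH HA Ea ai ij ik jk). Qed.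

Lemma is_minor_eq0 th r : log_der A1 th -> is_minor th r -> pr r = 0 ->
  exists u psi, log_der A psi /\ th = u *: E + al *: psi.
Proof.
move=> D M r0; apply: (euler_minor_eq0 arrA hH HA Ea ai ij ik jk D).
by rewrite M r0 mul0r.
Qed.

Lemma is_minor_eq0_homog d th r : log_der A1 th -> der_homog d.+1 th ->
  is_minor th r -> pr r = 0 ->
  exists u psi, [/\ log_der A psi, th = u *: E + al *: psi,
    u \is d.-homog & der_homog d psi].
Proof.
move=> D hd M r0; apply: (euler_minor_eq0_homog arrA hH HA Ea ai ij ik jk D hd).
by rewrite M r0 mul0r.
Qed.

Lemma mpolyX_neq0 m : 'X_m != 0 :> S.
Proof. by rewrite -linear_form_coord linear_form_eq0 coord_form_neq0. Qed.

(** The witness is Q(A) times a constant derivation along H, with minor Q(A) x_j. *)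
Lemma minor_nontrivial : exists th r, [/\ log_der A1 th, is_minor th r & pr r != 0].
Proof.
pose th : Der := defpoly A *: row k (adapted_mx a i).
have D : log_der A1 th by apply: adapted_mx_log_der.
have [r M] := minor_ex D; exists th, r; split=> //.
apply/eqP => r0; move: M; rewrite /is_minor r0 mul0r.
have -> : euler_minor j k th = defpoly A * 'X_j.
  rewrite euler_minorZ /euler_minor !mxE eqxx [k == i]eq_sym (negbTE ik).
  by rewrite [j == i]eq_sym (negbTE ij) (negbTE jk) /=; ring.
rewrite projM (proj_X _ (m := j)) 1?eq_sym // => /eqP.
rewrite mulf_eq0 (negbTE (mpolyX_neq0 j)) orbF => /eqP/(proj_subst_eq0 _ av).
exact: (defpoly_ndvd arrA hH HA Ea).
Qed.

Lemma euler_scale c x : al *: x = c *: E -> pr c = 0.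
Proof.
move/rowP/(_ j); rewrite !mxE => /(congr1 pr).
rewrite !projM pr_al mul0r (proj_X _ (m := j)) 1?eq_sym // => /esym/eqP.
by rewrite mulf_eq0 (negbTE (mpolyX_neq0 j)) orbF => /eqP.
Qed.

Lemma al_cancel x y : al *: x = al *: y -> x = y.
Proof.
by move=> e; apply/rowP => m; apply: (mulfI al0); move/rowP/(_ m): e; rewrite !mxE.
Qed.

Lemma restriction_card : (0 < h <= n)%N.
Proof.
rewrite leq_imfset_card andbT cardfs_gt0.
have /fset0Pn[L LA] := nA; apply/fset0Pn; exists (L :&: H)%VS.
by apply/imfsetP; exists L.
Qed.

Lemma al_scale_homog d th : der_homog d th -> der_homog d.+1 (al *: th).
Proof.
apply: der_homogZ; apply: homog_in_degree_diff (linear_form_homog a) _.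
by rewrite add1n.
Qed.

Lemma arrA1 : is_arrangement A1.
Proof. by move=> L; rewrite in_fset1U => /orP[/eqP->|/arrA]. Qed.

Lemma nA1 : A1 != fset0.
Proof. by apply/fset0Pn; exists H; rewrite fset1U1. Qed.

Lemma cardA1 : #|` A1| = n.+1.
Proof. by rewrite cardfsU1 HA. Qed.

(** T kills E and [th3] but is not zero, so T(th2) is nonzero. A combination then lies in D(A1)
    exactly when its coefficient at [th2] is divisible by alpha. *)
Lemma free_add_basis d e th2 th3 : free_basis A 1 d e E th2 th3 ->
  log_der A1 th3 -> free_basis A1 1 d.+1 e E (al *: th2) th3 /\ h = e.+1.
Proof.
move=> B D13; have [[D1 D2 D3] [h1 h2 h3] gen ind] := B.
have [t2 T2 ht2] := trace_ex_homog D2 h2.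
have trace_comb c1 c2 c3 : is_trace (c1 *: E + c2 *: th2 + c3 *: th3) (c2 * t2).
  have := is_traceD (is_traceD (is_traceZ c1 (is_trace0 (@DE A1))) (is_traceZ c2 T2))
    (is_traceZ c3 (is_trace0 D13)).
  by rewrite !mulr0 add0r addr0.
have nt2 : pr t2 != 0.
  have [x [t [/gen[c1 [c2 [c3 Ex]]] T nt]]] := trace_nontrivial.
  apply: contraNneq nt => t20; move: T; rewrite Ex.
  by move=> /is_trace_uniq/(_ (trace_comb c1 c2 c3))->; rewrite projM t20 mulr0.
have B1 : free_basis A1 1 d.+1 e E (al *: th2) th3.
  split=> //.
  - by split=> //; apply: log_der_al.
  - by split=> //; apply: al_scale_homog.
  - move=> et D1et; have [c1 [c2 [c3 Eet]]] := gen _ (log_der_A1_A D1et).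
    have := is_trace_uniq (is_trace0 D1et); rewrite {1}Eet => /(_ _ (trace_comb _ _ _)).
    rewrite rmorph0 projM => /esym/eqP; rewrite mulf_eq0 (negbTE nt2) orbF.
    move=> /eqP/proj_eq0_multiple[g Eg]; exists c1, g, c3.
    by rewrite scalerA -Eg.
  - move=> c1 c2 c3; rewrite scalerA => /ind[-> /eqP + ->].
    by rewrite mulf_eq0 (negbTE al0) orbF => /eqP->.
split=> //; have degA := free_basis_degree arrA nA B.
(* This bound and h <= e + 1 below, from a nonzero R(th3), become equalities because 1 + d + e =
   n. *)
have dt2 : (n - h <= d)%N.
  apply: (in_degree_diff_ge ht2); apply: contraNneq nt2 => ->.
  by rewrite rmorph0.
have [r3 M3 hr3] := minor_ex_homog D13 h3.
have dr3 : (h <= e.+1)%N.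
  apply: (in_degree_diff_ge hr3).
  have [x [r [D1x M nr]]] := minor_nontrivial.
  have [[_ _ _] _ gen1 _] := B1; have [c1 [c2 [c3 Ex]]] := gen1 _ D1x.
  apply: contraNneq nr => r30.
  have : is_minor x (c1 * 0 + c2 * 0 + c3 * r3).
    rewrite Ex; apply: is_minorD (is_minorZ _ M3).
    exact: is_minorD (is_minorZ _ is_minorE) (is_minorZ _ (is_minor_al _)).
  by move=> /(is_minor_uniq M)->; rewrite r30 !mulr0 !addr0 rmorph0.
have /andP[_ hn] := restriction_card.
by move: dt2 dr3 degA hn; move: n h => N m; clear; lia.
Qed.

Lemma homog0_der th : der_homog 0 th -> (forall m, (th 0 m)@_0%MM = 0) -> th = 0.
Proof.
by move=> h0 z; apply/rowP => m; rewrite (homog0_const (h0 m)) z mpolyC0 mxE.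
Qed.

(** Write th2 = u E + alpha psi; then psi replaces [th2]. For et in D(A), expand alpha et in the
    basis of D(A1): R forces the coefficient of [th3] to be divisible by alpha, [euler_scale] does
    the same for the remaining multiple of E, and alpha cancels. *)
Lemma free_del_basis d e th2 th3 r2 : free_basis A1 1 d e E th2 th3 ->
  is_minor th2 r2 -> pr r2 = 0 ->
  exists psi, [/\ (0 < d)%N, free_basis A 1 d.-1 e E psi th3 & (n - h = d.-1)%N].
Proof.
move=> B M2 r20; have [[D1 D2 D3] [h1 h2 h3] gen ind] := B.
case: d h2 B => [|d] h2 B.
  (* For d = 0 the coefficients of [th2] are constants, yet they vanish at the origin like those of
     E and alpha psi; so [th2] = 0, against independence. *)
  have [u [psi [_ Eth]]] := is_minor_eq0 D2 M2 r20.
  have th20 : th2 = 0.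
    apply: homog0_der h2 _ => m; rewrite Eth !mxE raddfD /= !coeff0M.
    rewrite (homog_coeff0 (linear_form_homog a)) // mul0r addr0.
    have := homog_coeff0 (hE m) isT; rewrite mxE => ->.
    by rewrite mulr0.
  have [|_ /eqP] := ind 0 1 0; last by rewrite oner_eq0.
  by rewrite th20 scaler0 !scale0r !addr0.
have [u [psi [Dpsi Eth hu hpsi]]] := is_minor_eq0_homog D2 h2 M2 r20.
have [r3 M3 hr3] := minor_ex_homog D3 h3.
have minor_comb c1 c2 c3 : is_minor (c1 *: E + c2 *: th2 + c3 *: th3) (c2 * r2 + c3 * r3).
  have := is_minorD (is_minorD (is_minorZ c1 is_minorE) (is_minorZ c2 M2))
    (is_minorZ c3 M3).
  by rewrite mulr0 add0r.
have nr3 : pr r3 != 0.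
  have [x [t [/gen[c1 [c2 [c3 Ex]]] T nt]]] := minor_nontrivial.
  apply: contraNneq nt => r30; move: T; rewrite Ex.
  move=> /is_minor_uniq/(_ (minor_comb c1 c2 c3))->.
  by rewrite rmorphD !rmorphM /= r20 r30 !mulr0 addr0.
have B0 : free_basis A 1 d e E psi th3.
  split=> //.
  - by split=> //; apply: log_der_A1_A.
  - move=> et Det; have [c1 [c2 [c3 Eet]]] := gen _ (log_der_al Det).
    have := is_minor_uniq (is_minor_al et); rewrite {1}Eet => /(_ _ (minor_comb _ _ _)).
    rewrite rmorph0 rmorphD !rmorphM /= r20 mulr0 add0r => /esym/eqP.
    rewrite mulf_eq0 (negbTE nr3) orbF => /eqP/proj_eq0_multiple[g Eg].
    move: Eet; rewrite Eth Eg => /lincomb_del Ed.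
    have /proj_eq0_multiple[g1 Eg1] := euler_scale Ed.
    move: Ed; rewrite Eg1 [g1 * _]mulrC -scalerA => /al_cancel Ed.
    exists g1, c2, g; rewrite -Ed addrAC subrK subrK //.
  - move=> c1 c2 c3 /(lincomb_scale al u); rewrite -Eth => /ind[e1 e2 e3].
    move: e1 e3; rewrite e2 mul0r subr0 => /eqP; rewrite mulf_eq0 (negbTE al0) => /eqP->.
    by move/eqP; rewrite mulf_eq0 (negbTE al0) => /eqP->.
exists psi; split=> //; have degA := free_basis_degree arrA1 nA1 B.
have dr3 : (h <= e.+1)%N.
  apply: (in_degree_diff_ge hr3); apply: contraNneq nr3 => ->.
  by rewrite rmorph0.
have [t T ht] := trace_ex_homog Dpsi hpsi.
have dt : (n - h <= d)%N.
  apply: (in_degree_diff_ge ht).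
  have [x [s [Dx Tx ns]]] := trace_nontrivial.
  have [[_ _ _] _ gen0 _] := B0; have [c1 [c2 [c3 Ex]]] := gen0 _ Dx.
  apply: contraNneq ns => t0.
  have : is_trace x (c1 * 0 + c2 * t + c3 * 0).
    rewrite Ex; apply: is_traceD (is_traceZ _ (is_trace0 D3)).
    exact: is_traceD (is_traceZ _ (is_trace0 (@DE A1))) (is_traceZ _ T).
  by move=> /(is_trace_uniq Tx)->; rewrite t0 !mulr0 !addr0 rmorph0.
have /andP[_ hn] := restriction_card.
by rewrite cardA1 in degA; move: dt dr3 degA hn; move: n h => N m; clear; lia.
Qed.


(** * From freeness to the deletion and the addition *)

Lemma in_degree_diff_const r d : in_degree_diff r d d -> pr r != 0 ->
  exists2 c : K, c != 0 & r = c%:MP.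
Proof.
move=> /in_degree_diff_homog; rewrite subnn => /homog0_const Er nr.
by exists r@_0%MM => //; apply: contraNneq nr => c0; rewrite Er c0 mpolyC0 rmorph0.
Qed.

Lemma scale_const (c : K) r : c != 0 -> r - (c^-1 *: r) * c%:MP = 0.
Proof.
move=> c0; rewrite -scalerAl mulrC mul_mpolyC scalerA mulVf // scale1r.
by rewrite subrr.
Qed.

(** For h = d + 1 the value R(th2) is a nonzero constant, so subtracting a multiple of [th2] from
    [th3] kills R(th3). The multiplier has degree e - d, so the exponents are kept. *)
Lemma deletion_const d e th2 th3 r2 : free_basis A1 1 d e E th2 th3 ->
  is_minor th2 r2 -> in_degree_diff r2 d.+1 h -> pr r2 != 0 -> h = d.+1 ->
  [/\ (0 < e)%N, free_with_exp A [tuple 1%N; d; e.-1] & (n - h = e.-1)%N].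
Proof.
move=> B M2 hr2 nr2 Eh; have [[_ _ D3] [_ _ h3] _ _] := B.
rewrite Eh in hr2; have [c c0 Er2] := in_degree_diff_const hr2 nr2.
have [r3 M3 hr3] := minor_ex_homog D3 h3.
rewrite Eh in_degree_diffS in hr3.
have B' := free_basis_shift B (in_degree_diffZ c^-1 hr3).
have M3' := is_minorB M3 (is_minorZ (c^-1 *: r3) M2).
have [|psi [e0 B0 En]] := free_del_basis (free_basis_swap23 B') M3'.
  by rewrite Er2 scale_const // rmorph0.
split=> //; apply/free_basisP; exists E, th2, psi.
exact: free_basis_swap23.
Qed.

Lemma deletion_plus_one_generated d e th2 th3 r2 r3 strict :
  free_basis A1 1 d e E th2 th3 -> is_minor th2 r2 -> is_minor th3 r3 ->
  in_degree_diff r2 d.+1 h -> in_degree_diff r3 e.+1 h ->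
  pr r2 != 0 -> pr r3 != 0 -> (h <= d)%N -> (h <= e)%N ->
  plus_one_generated strict A [tuple 1%N; d; e] (n - h).
Proof.
move=> B M2 M3 hr2 hr3 nr2 nr3 hd he.
have [[_ D2 D3] [_ h2 h3] gen ind] := B.
have degA := free_basis_degree arrA1 nA1 B; rewrite cardA1 in degA.
have /andP[hpos hn] := restriction_card.
have {degA}degA : (n = d + e)%N by move: degA; move: n => N; clear; lia.
have deg3 : (e.+1 - h + d = (n - h).+1)%N.
  by rewrite degA; move: hd he; move: h => m; clear; lia.
have deg2 : (d.+1 - h + e = (n - h).+1)%N.
  by rewrite degA; move: hd he; move: h => m; clear; lia.
(* Needed for minimality: the coefficient u of E has degree n - h and must vanish at the origin. *)
have npos : (0 < n - h)%N.
  by rewrite degA; move: hd he hpos; move: h => m; clear; lia.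
have hr3' := homog_in_degree_diff (in_degree_diff_homog hr3) deg3.
have hr2' := homog_in_degree_diff (in_degree_diff_homog hr2) deg2.
pose x := r3 *: th2 - r2 *: th3.
have Dx : log_der A1 x by apply: log_derB; apply: log_derZ.
have hx : der_homog (n - h).+1 x.
  by apply: der_homogB; [apply: der_homogZ hr3' h2|apply: der_homogZ hr2' h3].
have Mx : is_minor x (r3 * r2 - r2 * r3).
  exact: is_minorB (is_minorZ _ M2) (is_minorZ _ M3).
have [|u [psi [Dpsi Ex hu hpsi]]] := is_minor_eq0_homog Dx hx Mx.
  by rewrite [r2 * r3]mulrC subrr rmorph0.
have [t T ht] := trace_ex_homog Dpsi hpsi.
(* Otherwise psi would lie in D(A1), and comparing coefficients of [th2] in the free basis would
   give r3 as a multiple of alpha. *)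
have nt : pr t != 0.
  apply/eqP => t0; have [c1 [c2 [c3 Epsi]]] := gen _ (is_trace_eq0 Dpsi T t0).
  have /ind[_ /eqP + _] := lincomb_expand Ex Epsi.
  by rewrite subr_eq0 => /eqP E3; move: nr3; rewrite -E3 projM pr_al mul0r eqxx.
have [c c0 Et] := in_degree_diff_const ht nt.
have z2 : r2@_0%MM = 0.
  by apply: (homog_coeff0 (in_degree_diff_homog hr2)); rewrite subn_gt0.
have z3 : r3@_0%MM = 0.
  by apply: (homog_coeff0 (in_degree_diff_homog hr3)); rewrite subn_gt0.
suff rel : one_relation A th2 th3 psi u (- r3) r2 al.
  apply: (one_relation_plus_one_generated _ rel) => //.
    by apply: (homog_in_degree_diff hu); rewrite addn1.
  exact: in_degree_diffN.
split.
- by split=> //; apply: log_der_A1_A.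
- move=> et Det; have [s Ts] := trace_ex Det.
  (* T(psi) is the constant c, so this multiple of psi has the same trace as [et]. *)
  have Dy : log_der A1 (et - (c^-1 *: s) *: psi).
    apply: (is_trace_eq0 (log_derB Det (log_derZ _ Dpsi))).
      exact: is_traceB Ts (is_traceZ (c^-1 *: s) T).
    by rewrite Et scale_const // rmorph0.
  have [c1 [c2 [c3 Ey]]] := gen _ Dy.
  by exists c1, c2, c3, (c^-1 *: s); rewrite -Ey subrK.
- move=> c1 c2 c3 c4; split.
    move=> e0; have : is_trace (c1 *: E + c2 *: th2 + c3 *: th3 + c4 *: psi)
        (0 + c4 * t).
      apply: is_traceD (is_traceZ _ T); apply: is_trace0.
      by apply: log_derD; [apply: log_derD|]; apply: log_derZ.
    rewrite e0 add0r => /is_trace_uniq/(_ (is_trace0 _)).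
    rewrite rmorph0 projM => /(_ _)/eqP; rewrite mulf_eq0 (negbTE nt) orbF => c40.
    have {c40}/proj_eq0_multiple[g Eg] : pr c4 = 0.
      apply/eqP/c40; rewrite -(scale0r E); apply: log_derZ; exact: DE.
    move: e0; rewrite Eg (lincomb_relation _ _ _ _ Ex) => /ind[e1 e2 e3].
    exists g; split=> //.
    + by apply/eqP; rewrite -subr_eq0 e1.
    + by rewrite mulrN; apply/eqP; rewrite -addr_eq0 e2.
    + by apply/eqP; rewrite -subr_eq0 e3.
  move=> [g [-> -> -> ->]]; rewrite (lincomb_relation _ _ _ _ Ex).
  by rewrite mulrN addNr !subrr !scale0r !addr0.
- split=> //; [|by rewrite raddfN /= z3 oppr0|].
    exact: (homog_coeff0 hu).
  exact: (homog_coeff0 (linear_form_homog a)).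
by move=> [_ _ _ /eqP]; rewrite (negbTE al0).
Qed.

Lemma deletion_of_free d e strict : free_with_exp A1 [tuple 1%N; d; e] ->
  ([/\ (0 < e)%N, free_with_exp A [tuple 1%N; d; e.-1] & (n - h = e.-1)%N] \/
   [/\ (0 < d)%N, free_with_exp A [tuple 1%N; e; d.-1] & (n - h = d.-1)%N]) \/
  plus_one_generated strict A [tuple 1%N; d; e] (n - h).
Proof.
move=> /(free_basis_euler arrA1 nA1)[th2 [th3 B]].
have [[_ D2 D3] [_ h2 h3] _ _] := B; have B' := free_basis_swap23 B.
have [r2 M2 hr2] := minor_ex_homog D2 h2.
have [r3 M3 hr3] := minor_ex_homog D3 h3.
have [r20|nr2] := eqVneq (pr r2) 0.
  have [psi [d0 B0 En]] := free_del_basis B M2 r20.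
  left; right; split=> //; apply/free_basisP; exists E, th3, psi.
  exact: free_basis_swap23.
have [r30|nr3] := eqVneq (pr r3) 0.
  have [psi [e0 B0 En]] := free_del_basis B' M3 r30.
  left; left; split=> //; apply/free_basisP; exists E, th2, psi.
  exact: free_basis_swap23.
have r2n0 : r2 != 0 by apply: contraNneq nr2 => ->; rewrite rmorph0.
have r3n0 : r3 != 0 by apply: contraNneq nr3 => ->; rewrite rmorph0.
have := in_degree_diff_ge hr2 r2n0; rewrite leq_eqVlt ltnS => /orP[/eqP hd|hd].
  by left; left; apply: (deletion_const B M2 hr2 nr2 hd).
have := in_degree_diff_ge hr3 r3n0; rewrite leq_eqVlt ltnS => /orP[/eqP he|he].
  by left; right; apply: (deletion_const B' M3 hr3 nr3 he).
by right; apply: (deletion_plus_one_generated _ B M2 M3).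
Qed.

(** For n - h = e the value T(th3) is a nonzero constant, and a multiple of [th3] subtracted from
    [th2] moves it into D(A1). *)
Lemma addition_const d e th2 th3 t3 : free_basis A 1 d e E th2 th3 ->
  is_trace th3 t3 -> in_degree_diff t3 e (n - h) -> pr t3 != 0 -> (n - h = e)%N ->
  free_with_exp A1 [tuple 1%N; d; e.+1] /\ h = d.+1.
Proof.
move=> B T3 ht3 nt3 Enh; have [[_ D2 _] [_ h2 _] _ _] := B.
rewrite Enh in ht3; have [c c0 Et3] := in_degree_diff_const ht3 nt3.
have [t2 T2 ht2] := trace_ex_homog D2 h2.
rewrite Enh in ht2.
have B' := free_basis_shift (free_basis_swap23 B) (in_degree_diffZ c^-1 ht2).
have T2' := is_traceB T2 (is_traceZ (c^-1 *: t2) T3).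
have [[_ _ D2'] _ _ _] := B'.
have D12 : log_der A1 (th2 - (c^-1 *: t2) *: th3).
  by apply: (is_trace_eq0 D2' T2'); rewrite Et3 scale_const // rmorph0.
have [B1 Eh] := free_add_basis B' D12; split=> //.
by apply/free_basisP; exists E, (th2 - (c^-1 *: t2) *: th3), (al *: th3);
   apply: free_basis_swap23.
Qed.

Lemma addition_plus_one_generated d e th2 th3 t2 t3 strict :
  free_basis A 1 d e E th2 th3 -> is_trace th2 t2 -> is_trace th3 t3 ->
  in_degree_diff t2 d (n - h) -> in_degree_diff t3 e (n - h) ->
  pr t2 != 0 -> pr t3 != 0 -> (n - h < d)%N -> (n - h < e)%N ->
  plus_one_generated strict A1 [tuple 1%N; d.+1; e.+1] (h - 1).
Proof.
move=> B T2 T3 ht2 ht3 nt2 nt3 hd he.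
have [[_ D2 D3] [_ h2 h3] gen ind] := B.
have degA := free_basis_degree arrA nA B.
have /andP[hpos hn] := restriction_card.
have deg3 : (e - (n - h) + d = h - 1)%N.
  by move: degA hn hd he; move: n h => N m; clear; lia.
have deg2 : (d - (n - h) + e = h - 1)%N.
  by move: degA hn hd he; move: n h => N m; clear; lia.
have hh : (h - 1).+1 = h by rewrite subn1 prednK.
have ht3' := homog_in_degree_diff (in_degree_diff_homog ht3) deg3.
have ht2' := homog_in_degree_diff (in_degree_diff_homog ht2) deg2.
pose x := t3 *: th2 - t2 *: th3.
have Dx : log_der A x by apply: log_derB; apply: log_derZ.
have hx : der_homog (h - 1) x.
  by apply: der_homogB; [apply: der_homogZ ht3' h2|apply: der_homogZ ht2' h3].
have Tx : is_trace x (t3 * t2 - t2 * t3).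
  exact: is_traceB (is_traceZ _ T2) (is_traceZ _ T3).
have D1x : log_der A1 x.
  by apply: (is_trace_eq0 Dx Tx); rewrite [t2 * t3]mulrC subrr rmorph0.
have [r M hr] := minor_ex_homog D1x hx.
(* Otherwise x = u E + alpha psi with psi in D(A), and comparing coefficients of [th2] would make t3
   a multiple of alpha. *)
have nr : pr r != 0.
  apply/eqP => r0; have [u [psi [Dpsi Ex]]] := is_minor_eq0 D1x M r0.
  have [c1 [c2 [c3 Epsi]]] := gen _ Dpsi.
  have /ind[_ /eqP + _] := lincomb_expand Ex Epsi.
  by rewrite subr_eq0 => /eqP E3; move: nt3; rewrite -E3 projM pr_al mul0r eqxx.
rewrite hh in hr; have [c c0 Er] := in_degree_diff_const hr nr.
have z2 : t2@_0%MM = 0.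
  by apply: (homog_coeff0 (in_degree_diff_homog ht2)); rewrite subn_gt0.
have z3 : t3@_0%MM = 0.
  by apply: (homog_coeff0 (in_degree_diff_homog ht3)); rewrite subn_gt0.
(* The relation is alpha times the definition of x, so E does not occur in it. *)
suff rel : one_relation A1 (al *: th2) (al *: th3) x 0 (- t3) t2 al.
  apply: (one_relation_plus_one_generated _ rel) => //; try exact: al_scale_homog.
  - by rewrite /in_degree_diff; case: ltnP => // _; apply: dhomog0.
  - by apply: in_degree_diffN; rewrite in_degree_diffS.
split.
- by split=> //; apply: log_der_al.
- move=> et Det; have [s Ms] := minor_ex Det.
  have Dy : log_der A1 (et - (c^-1 *: s) *: x) by apply/log_derB/log_derZ.
  have [|u [psi [Dpsi Ey]]] := is_minor_eq0 Dy (is_minorB Ms (is_minorZ (c^-1 *: s) M)).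
    by rewrite Er scale_const // rmorph0.
  have [c1 [c2 [c3 Epsi]]] := gen _ Dpsi.
  exists (u + al * c1), c2, c3, (c^-1 *: s).
  by rewrite -lincomb_add_gen -Epsi -Ey subrK.
- move=> c1 c2 c3 c4; rewrite lincomb_add_rel; split.
    move=> /ind[-> e2 e3].
    have [g Eg] : exists g, c4 = g * al.
      apply: proj_eq0_multiple; have := congr1 pr e2.
      rewrite rmorphD /= !projM pr_al mulr0 add0r rmorph0 => /eqP.
      by rewrite mulf_eq0 (negbTE nt3) orbF => /eqP.
    exists g; split; rewrite ?mulr0 //.
    + apply: (mulIf al0); apply/eqP; rewrite -subr_eq0 -[X in _ == X]e2 Eg.
      by apply/eqP; ring.
    + apply: (mulIf al0); apply/eqP; rewrite -subr_eq0 -[X in _ == X]e3 Eg.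
      by apply/eqP; ring.
  move=> [g [-> -> -> ->]].
  have -> : g * - t3 * al + g * al * t3 = 0 by ring.
  have -> : g * t2 * al - g * al * t2 = 0 by ring.
  by rewrite mulr0 !scale0r !addr0.
- split=> //; [by rewrite mcoeff0|by rewrite raddfN /= z3 oppr0|].
  exact: (homog_coeff0 (linear_form_homog a)).
by move=> [_ _ _ /eqP]; rewrite (negbTE al0).
Qed.

Lemma addition_of_free d e strict : free_with_exp A [tuple 1%N; d; e] ->
  ((free_with_exp A1 [tuple 1%N; d; e.+1] /\ h = d.+1) \/
   (free_with_exp A1 [tuple 1%N; e; d.+1] /\ h = e.+1)) \/
  plus_one_generated strict A1 [tuple 1%N; d.+1; e.+1] (h - 1).
Proof.
move=> /(free_basis_euler arrA nA)[th2 [th3 B]].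
have [[_ D2 D3] [_ h2 h3] _ _] := B; have B' := free_basis_swap23 B.
have [t2 T2 ht2] := trace_ex_homog D2 h2.
have [t3 T3 ht3] := trace_ex_homog D3 h3.
have [t20|nt2] := eqVneq (pr t2) 0.
  have [B1 Eh] := free_add_basis B' (is_trace_eq0 D2 T2 t20).
  left; left; split=> //; apply/free_basisP; exists E, th2, (al *: th3).
  exact: free_basis_swap23.
have [t30|nt3] := eqVneq (pr t3) 0.
  have [B1 Eh] := free_add_basis B (is_trace_eq0 D3 T3 t30).
  left; right; split=> //; apply/free_basisP; exists E, th3, (al *: th2).
  exact: free_basis_swap23.
have t2n0 : t2 != 0 by apply: contraNneq nt2 => ->; rewrite rmorph0.
have t3n0 : t3 != 0 by apply: contraNneq nt3 => ->; rewrite rmorph0.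
have := in_degree_diff_ge ht3 t3n0; rewrite leq_eqVlt => /orP[/eqP he|he].
  by left; left; apply: (addition_const B T3 ht3 nt3 he).
have := in_degree_diff_ge ht2 t2n0; rewrite leq_eqVlt => /orP[/eqP hd|hd].
  by left; right; apply: (addition_const B' T2 ht2 nt2 hd).
by right; apply: (addition_plus_one_generated _ B T2 T3).
Qed.

(** * From a free deletion or addition back to freeness *)

Lemma free_of_free_deletion d e : free_with_exp A [tuple 1%N; d; e] ->
  (n - h = e)%N -> free_with_exp A1 [tuple 1%N; d; e.+1].
Proof.
move=> /(free_basis_euler arrA nA)[th2 [th3 B]] Enh.
have [[_ D2 D3] [_ h2 h3] _ _] := B.
have [t3 T3 ht3] := trace_ex_homog D3 h3.
have [t30|nt3] := eqVneq (pr t3) 0; last first.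
  by have [] := addition_const B T3 ht3 nt3 Enh.
have [B1 Eh] := free_add_basis B (is_trace_eq0 D3 T3 t30).
have degA := free_basis_degree arrA nA B.
(* Here [th2] is the generator whose degree grows; the cardinals force d = e, so the exponents still
   agree. *)
have Ed : d = e by move: degA Enh Eh; move: n h => N m; clear; lia.
suff : free_with_exp A1 [tuple 1%N; e; d.+1] by rewrite Ed.
by apply/free_basisP; exists E, th3, (al *: th2); apply: free_basis_swap23.
Qed.

Lemma free_of_free_addition d e : free_with_exp A1 [tuple 1%N; d; e.+1] ->
  h = d.+1 -> free_with_exp A [tuple 1%N; d; e].
Proof.
move=> /(free_basis_euler arrA1 nA1)[th2 [th3 B]] Eh.
have [[_ D2 D3] [_ h2 h3] _ _] := B.
have [r2 M2 hr2] := minor_ex_homog D2 h2.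
have [r20|nr2] := eqVneq (pr r2) 0; last first.
  by have [] := deletion_const B M2 hr2 nr2 Eh.
have [psi [d0 B0 En]] := free_del_basis B M2 r20.
have degA := free_basis_degree arrA nA B0.
(* The basis found has exponents 1, d - 1, e + 1; the cardinals force d - 1 = e, which turns them
   into 1, e, d. *)
have Ed : d.-1 = e by move: degA d0 En Eh; move: n h => N m; clear; lia.
have Ee : e.+1 = d by rewrite -Ed prednK.
apply/free_basisP; exists E, th3, psi; apply: free_basis_swap23.
by rewrite Ed Ee in B0.
Qed.

(** * From plus-one generatedness back to freeness *)

Lemma is_trace_comb et1 et2 et3 t1 t2 t3 c0 c1 c2 c3 :
  is_trace et1 t1 -> is_trace et2 t2 -> is_trace et3 t3 ->
  is_trace (c0 *: E + c1 *: et1 + c2 *: et2 + c3 *: et3)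
    (c1 * t1 + c2 * t2 + c3 * t3).
Proof.
move=> T1 T2 T3; rewrite -[c1 * t1]add0r -(mulr0 c0).
apply: is_traceD (is_traceZ _ T3); apply: is_traceD (is_traceZ _ T2).
exact: is_traceD (is_traceZ _ (is_trace0 (@DE A1))) (is_traceZ _ T1).
Qed.

Lemma is_minor_comb et1 et2 et3 r1 r2 r3 c0 c1 c2 c3 :
  is_minor et1 r1 -> is_minor et2 r2 -> is_minor et3 r3 ->
  is_minor (c0 *: E + c1 *: et1 + c2 *: et2 + c3 *: et3)
    (c1 * r1 + c2 * r2 + c3 * r3).
Proof.
move=> M1 M2 M3; rewrite -[c1 * r1]add0r -(mulr0 c0).
apply: is_minorD (is_minorZ _ M3); apply: is_minorD (is_minorZ _ M2).
exact: is_minorD (is_minorZ _ is_minorE) (is_minorZ _ M1).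
Qed.

(** Once T vanishes on [x1] and [x2], a combination lies in D(A1) exactly when its coefficient at
    [et3] is divisible by alpha. The relation represents 0, so its own last coefficient is a nonzero
    constant times alpha, and it removes every multiple of alpha [et3]. *)
Lemma free_of_relation_deletion (d1 d2 : nat) et1 et2 et3 f0 f1 f2 f3 t3 :
  one_relation A et1 et2 et3 f0 f1 f2 f3 ->
  der_homog d1 et1 -> der_homog d2 et2 -> der_homog (n - h) et3 ->
  (d1 <= n - h)%N -> (d2 <= n - h)%N ->
  f1 \is ((n - h).+1 - d1)%N.-homog -> f2 \is ((n - h).+1 - d2)%N.-homog ->
  f3 \is 1.-homog ->
  is_trace et3 t3 -> in_degree_diff t3 (n - h) (n - h) -> pr t3 != 0 ->
  free_with_exp A1 [tuple 1%N; d1; d2].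
Proof.
move=> rel h1 h2 h3 d1l d2l hf1 hf2 hf3 T3 ht3 nt3.
have [[D1 D2 D3] _ _ _ _] := rel.
have [c c0 Et3] := in_degree_diff_const ht3 nt3.
have [t1 T1 ht1] := trace_ex_homog D1 h1.
have [t2 T2 ht2] := trace_ex_homog D2 h2.
pose k1 := c^-1 *: t1; pose k2 := c^-1 *: t2.
have hk1 : in_degree_diff k1 d1 (n - h) by apply: in_degree_diffZ.
have hk2 : in_degree_diff k2 d2 (n - h) by apply: in_degree_diffZ.
have := one_relation_shift 0 0 k1 k2 rel; rewrite scale0r !subr0 !mul0r !addr0.
set x1 := et1 - _; set x2 := et2 - _; set f3' := f3 + _ + _.
move=> rel'.
have Tx1 : is_trace x1 0.
  have := is_traceB T1 (is_traceZ k1 T3).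
  by rewrite Et3 scale_const.
have Tx2 : is_trace x2 0.
  have := is_traceB T2 (is_traceZ k2 T3).
  by rewrite Et3 scale_const.
have hx1 : der_homog d1 x1 by apply: der_homogB => //; apply: der_homogZ hk1 h3.
have hx2 : der_homog d2 x2 by apply: der_homogB => //; apply: der_homogZ hk2 h3.
(* The multipliers [k1] and [k2] vanish unless the generator they shift has the degree n - h of
   [et3]. *)
have hf3' : f3' \is 1.-homog.
  apply: rpredD (in_degree_diff_scale_homog hk2 d2l hf2).
  exact: rpredD hf3 (in_degree_diff_scale_homog hk1 d1l hf1).
have nf3' : f3' != 0 by apply: one_relation_neq0 arrA nA rel'.
clearbody x1 x2 f3'; have [[Dx1 Dx2 _] gen syz _ _] := rel'.
have trace_coef c0' c1 c2 c3 : log_der A1 (c0' *: E + c1 *: x1 + c2 *: x2 + c3 *: et3) ->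
    exists g, c3 = g * al.
  move=> D; apply: proj_eq0_multiple; have := is_trace_uniq (is_trace0 D).
  move=> /(_ _ (is_trace_comb c0' c1 c2 c3 Tx1 Tx2 T3)).
  rewrite !mulr0 !add0r projM rmorph0 => /esym/eqP.
  by rewrite mulf_eq0 (negbTE nt3) orbF => /eqP.
have rel0 : f0 *: E + f1 *: x1 + f2 *: x2 + f3' *: et3 = 0.
  by apply/syz; exists 1; rewrite !mul1r.
have dv : divides al f3'.
  apply: (trace_coef f0 f1 f2); rewrite rel0 -(scale0r E).
  exact: log_derZ (@DE A1).
have [c' c'0 Ef3'] := homog1_multiple dv hf3' nf3'.
have c'V : c'^-1%:MP * c'%:MP = 1 :> S by rewrite -mpolyCM mulVf.
rewrite Ef3' in rel0.
apply/free_basisP; exists E, x1, x2; split=> //.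
- by split; [exact: DE| |]; apply: is_trace_eq0 (rmorph0 _).
- move=> et Det; have [c0' [c1 [c2 [c3 Eet]]]] := gen _ (log_der_A1_A Det).
  have [|g Eg] := trace_coef c0' c1 c2 c3; first by rewrite -Eet.
  exists (c0' - g * c'^-1%:MP * f0), (c1 - g * c'^-1%:MP * f1),
    (c2 - g * c'^-1%:MP * f2).
  by rewrite Eet Eg (lincomb_elim _ _ _ _ c'V rel0).
- move=> c0' c1 c2 e0; have [|g [e1 e2 e3 e4]] := (syz c0' c1 c2 0).1.
    by rewrite scale0r addr0.
  have g0 : g = 0.
    by apply/eqP; move/esym/eqP: e4; rewrite mulf_eq0 (negbTE nf3') orbF.
  by rewrite e1 e2 e3 g0 !mul0r.
Qed.

Lemma free_of_plus_one_generated_deletion d e strict :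
  plus_one_generated strict A [tuple 1%N; d; e] (n - h) ->
  free_with_exp A1 [tuple 1%N; d; e].
Proof.
move=> /plus_one_generated_one_relation[et1 [et2 [et3 [f0 [f1 [f2 [f3]]]]]]].
move=> [rel [h1 h2 h3] hf1 hf2 hf3].
have rel1 := one_relation_swap23 (one_relation_swap12 rel).
have rel2 := one_relation_swap23 rel.
have [[D1 D2 D3] gen _ [_ z1 z2 z3] _] := rel.
have dl := relation_degree hf1 z1 (one_relation_neq0 arrA nA rel1).
have el := relation_degree hf2 z2 (one_relation_neq0 arrA nA rel2).
have {}hf1 := in_degree_diff_homog hf1; have {}hf2 := in_degree_diff_homog hf2.
have [t1 T1 ht1] := trace_ex_homog D1 h1.
have [t2 T2 ht2] := trace_ex_homog D2 h2.
have [t3 T3 ht3] := trace_ex_homog D3 h3.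
(* A generator with nonzero trace has degree at least n - h, hence equal to the level, and can
   exchange roles with [et3]. *)
have top (m : nat) t : in_degree_diff t m (n - h) -> pr t != 0 -> (m <= n - h)%N ->
    m = (n - h)%N.
  move=> ht nt ml; apply/eqP; rewrite eqn_leq ml /=; apply: (in_degree_diff_ge ht).
  by apply: contraNneq nt => ->; rewrite rmorph0.
have hf3' : f3 \is ((n - h).+1 - (n - h))%N.-homog by rewrite subSnn.
have [t30|nt3] := eqVneq (pr t3) 0; last first.
  exact: (free_of_relation_deletion rel h1 h2 h3 dl el hf1 hf2 hf3 T3 ht3 nt3).
have [t20|nt2] := eqVneq (pr t2) 0; last first.
  have Ee := top _ _ ht2 nt2 el; subst e.
  rewrite subSnn in hf2.
  exact: (free_of_relation_deletion rel2 h1 h3 h2 dl (leqnn _) hf1 hf3' hf2 T2 ht2 nt2).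
have [t10|nt1] := eqVneq (pr t1) 0; last first.
  have Ed := top _ _ ht1 nt1 dl; subst d.
  rewrite subSnn in hf1; apply: free_with_exp_swap.
  exact: (free_of_relation_deletion rel1 h2 h3 h1 el (leqnn _) hf2 hf3' hf1 T1 ht1 nt1).
(* T cannot vanish on all generators, being nonzero on D(A). *)
have [x [t [/gen[c0 [c1 [c2 [c3 ->]]]] T]]] := trace_nontrivial.
rewrite (is_trace_uniq T (is_trace_comb c0 c1 c2 c3 T1 T2 T3)).
by rewrite !rmorphD !rmorphM /= t10 t20 t30 !mulr0 !addr0 => /eqP.
Qed.

Lemma al_divide g c0 c1 c2 et x y z :
  al *: et = c0 *: E + c1 *: (al *: x) + c2 *: (al *: y) + (g * al) *: z ->
  exists2 g', c0 = g' * al & et = g' *: E + c1 *: x + c2 *: y + g *: z.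
Proof.
move=> /lincomb_divide Ed; have /proj_eq0_multiple[g' Eg'] := euler_scale Ed.
exists g' => //; move: Ed; rewrite Eg' [g' * _]mulrC -scalerA => /al_cancel <-.
by rewrite !subrK.
Qed.

(** Being killed by R only means lying in S E + alpha D(A). So multiples of E are subtracted too,
    the new generators are alpha [x1] and alpha [x2], and E, [x1], [x2] is the basis sought. *)
Lemma free_of_relation_addition (d1 d2 : nat) et1 et2 et3 f0 f1 f2 f3 r3 :
  one_relation A1 et1 et2 et3 f0 f1 f2 f3 ->
  der_homog d1.+1 et1 -> der_homog d2.+1 et2 -> der_homog (h - 1) et3 ->
  (d1.+1 <= h - 1)%N -> (d2.+1 <= h - 1)%N ->
  f1 \is ((h - 1).+1 - d1.+1)%N.-homog -> f2 \is ((h - 1).+1 - d2.+1)%N.-homog ->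
  f3 \is 1.-homog ->
  is_minor et3 r3 -> in_degree_diff r3 (h - 1) (h - 1) -> pr r3 != 0 ->
  free_with_exp A [tuple 1%N; d1; d2].
Proof.
move=> rel h1 h2 h3 d1l d2l hf1 hf2 hf3 M3 hr3 nr3.
have [[D1 D2 D3] _ _ _ _] := rel.
have /andP[hpos _] := restriction_card.
have hh : (h - 1).+1 = h by rewrite subn1 prednK.
have [c c0 Er3] := in_degree_diff_const hr3 nr3.
have [r1 M1 hr1] := minor_ex_homog D1 h1.
have [r2 M2 hr2] := minor_ex_homog D2 h2.
rewrite -hh in_degree_diffS in hr1; rewrite -hh in_degree_diffS in hr2.
pose k1 := c^-1 *: r1; pose k2 := c^-1 *: r2.
have hk1 : in_degree_diff k1 d1.+1 (h - 1) by apply: in_degree_diffZ.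
have hk2 : in_degree_diff k2 d2.+1 (h - 1) by apply: in_degree_diffZ.
have split_off (d : nat) et r kk : log_der A1 et -> der_homog d.+1 et ->
    is_minor et r -> kk = c^-1 *: r -> in_degree_diff kk d.+1 (h - 1) ->
    exists u psi, [/\ log_der A psi, der_homog d psi &
      et - kk *: et3 - u *: E = al *: psi].
  move=> D hd M Ek hk.
  have Dx : log_der A1 (et - kk *: et3) by apply/log_derB/log_derZ.
  have hx : der_homog d.+1 (et - kk *: et3).
    by apply: der_homogB => //; apply: der_homogZ hk h3.
  have Mx := is_minorB M (is_minorZ kk M3).
  have [|u [psi [Dpsi Ex _ hpsi]]] := is_minor_eq0_homog Dx hx Mx.
    by rewrite Er3 Ek scale_const // rmorph0.
  by exists u, psi; split=> //; rewrite Ex addrC addKr.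
have [u1 [x1 [Dx1 hx1 Ex1]]] := split_off _ _ _ _ D1 h1 M1 erefl hk1.
have [u2 [x2 [Dx2 hx2 Ex2]]] := split_off _ _ _ _ D2 h2 M2 erefl hk2.
have := one_relation_shift u1 u2 k1 k2 rel; rewrite Ex1 Ex2.
set f0' := f0 + _ + _; set f3' := f3 + _ + _; move=> rel'.
have hf3' : f3' \is 1.-homog.
  apply: rpredD (in_degree_diff_scale_homog hk2 d2l hf2).
  exact: rpredD hf3 (in_degree_diff_scale_homog hk1 d1l hf1).
have nf3' : f3' != 0 by apply: one_relation_neq0 arrA1 nA1 rel'.
clearbody f0' f3'; have [_ gen syz _ _] := rel'.
have minor_coef et c0' c1 c2 c3 :
    al *: et = c0' *: E + c1 *: (al *: x1) + c2 *: (al *: x2) + c3 *: et3 ->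
    exists g, c3 = g * al.
  move=> Eet; apply: proj_eq0_multiple; have := is_minor_al et; rewrite Eet => /is_minor_uniq.
  move=> /(_ _ (is_minor_comb c0' c1 c2 c3 (is_minor_al x1) (is_minor_al x2) M3)).
  rewrite !mulr0 !add0r projM rmorph0 => /esym/eqP.
  by rewrite mulf_eq0 (negbTE nr3) orbF => /eqP.
(* Writing 0 as alpha times 0 makes [minor_coef] and [al_divide] apply to the relation itself. *)
have rel0 : al *: 0 = f0' *: E + f1 *: (al *: x1) + f2 *: (al *: x2) + f3' *: et3.
  by rewrite scaler0; apply/esym/syz; exists 1; rewrite !mul1r.
have dv : divides al f3' by apply: minor_coef rel0.
have [c' c'0 Ef3'] := homog1_multiple dv hf3' nf3'.
have c'V : c'^-1%:MP * c'%:MP = 1 :> S by rewrite -mpolyCM mulVf.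
(* Divided by alpha, the relation has the unit c' at [et3] and expresses it through E, [x1] and
   [x2]. *)
rewrite Ef3' in rel0; have [g0 _ /esym rel1] := al_divide rel0.
rewrite -[c'%:MP]mulr1 in rel1.
apply/free_basisP; exists E, x1, x2; split=> //.
- move=> et Det; have [c0' [c1 [c2 [c3 Eet]]]] := gen _ (log_der_al Det).
  have [g Eg] := minor_coef _ _ _ _ _ Eet.
  rewrite Eg in Eet; have [g' _ {}Eet] := al_divide Eet.
  exists (g' - g * c'^-1%:MP * g0), (c1 - g * c'^-1%:MP * f1),
    (c2 - g * c'^-1%:MP * f2).
  by rewrite Eet -[g in g *: et3]mulr1 (lincomb_elim _ _ _ _ c'V rel1).
- move=> c0' c1 c2 /(lincomb_scale3 al et3)/syz[g [e1 e2 e3 e4]].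
  have g00 : g = 0.
    by apply/eqP; move/esym/eqP: e4; rewrite mulf_eq0 (negbTE nf3') orbF.
  rewrite e2 e3 g00 !mul0r; split=> //; apply: (mulfI al0).
  by rewrite e1 g00 mul0r mulr0.
Qed.

Lemma free_of_plus_one_generated_addition d e strict :
  plus_one_generated strict A1 [tuple 1%N; d.+1; e.+1] (h - 1) ->
  free_with_exp A [tuple 1%N; d; e].
Proof.
move=> /plus_one_generated_one_relation[et1 [et2 [et3 [f0 [f1 [f2 [f3]]]]]]].
move=> [rel [h1 h2 h3] hf1 hf2 hf3].
have rel1 := one_relation_swap23 (one_relation_swap12 rel).
have rel2 := one_relation_swap23 rel.
have [[D1 D2 D3] gen _ [_ z1 z2 z3] _] := rel.
have dl := relation_degree hf1 z1 (one_relation_neq0 arrA1 nA1 rel1).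
have el := relation_degree hf2 z2 (one_relation_neq0 arrA1 nA1 rel2).
have {}hf1 := in_degree_diff_homog hf1; have {}hf2 := in_degree_diff_homog hf2.
have /andP[hpos _] := restriction_card.
have hh : (h - 1).+1 = h by rewrite subn1 prednK.
have [r1 M1 hr1] := minor_ex_homog D1 h1.
have [r2 M2 hr2] := minor_ex_homog D2 h2.
have [r3 M3 hr3] := minor_ex_homog D3 h3.
rewrite -hh in_degree_diffS in hr1; rewrite -hh in_degree_diffS in hr2.
rewrite -{2}hh in_degree_diffS in hr3.
have top (m : nat) t : in_degree_diff t m (h - 1) -> pr t != 0 -> (m <= h - 1)%N ->
    (h - 1)%N = m.
  move=> ht nt ml; apply/eqP; rewrite eqn_leq ml andbT; apply: (in_degree_diff_ge ht).
  by apply: contraNneq nt => ->; rewrite rmorph0.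
have [r30|nr3] := eqVneq (pr r3) 0; last first.
  exact: (free_of_relation_addition rel h1 h2 h3 dl el hf1 hf2 hf3 M3 hr3 nr3).
have [r20|nr2] := eqVneq (pr r2) 0; last first.
  have Ee := top _ _ hr2 nr2 el.
  apply: (free_of_relation_addition rel2 h1 _ _ dl _ hf1 _ _ M2) => //.
  - by rewrite -Ee.
  - by rewrite Ee.
  - by rewrite Ee subSnn.
  - by move: hf2; rewrite Ee subSnn.
  - by move: hr2; rewrite -Ee.
have [r10|nr1] := eqVneq (pr r1) 0; last first.
  have Ed := top _ _ hr1 nr1 dl; apply: free_with_exp_swap.
  apply: (free_of_relation_addition rel1 h2 _ _ el _ hf2 _ _ M1) => //.
  - by rewrite -Ed.
  - by rewrite Ed.
  - by rewrite Ed subSnn.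
  - by move: hf1; rewrite Ed subSnn.
  - by move: hr1; rewrite -Ed.
have [x [r [/gen[c0 [c1 [c2 [c3 ->]]]] M]]] := minor_nontrivial.
rewrite (is_minor_uniq M (is_minor_comb c0 c1 c2 c3 M1 M2 M3)).
by rewrite !rmorphD !rmorphM /= r10 r20 r30 !mulr0 !addr0 => /eqP.
Qed.

End AdditionDeletion.

(** * The equivalence *)

Lemma essential_neq0 (K : fieldType) (l : nat) (A : {fset {vspace 'rV[K]_l.+1}}) :
  essential A -> A != fset0.
Proof.
move=> essA; apply/eqP => A0; move: essA; rewrite /essential A0 big_nil.
by move=> /(congr1 (fun U => \dim U)); rewrite dim_rV dimv0.
Qed.

(** A single hyperplane in dimension at least two is not 0. The deletion has to be nonempty for
    [free_basis_euler] and [saito_degree]. *)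
Lemma essential_deletion_neq0 (K : fieldType) (l : nat)
    (A : {fset {vspace 'rV[K]_l.+2}}) H :
  is_arrangement A -> essential A -> H \in A -> (A `\ H)%fset != fset0.
Proof.
move=> arrA essA HA; apply/eqP => A0; move: essA.
rewrite /essential (big_fsetD1 H) //= A0 big_nil capvf => H0.
by have := arrA H HA; rewrite /is_hyperplane H0 dimv0.
Qed.

Lemma restriction_fset1U (K : fieldType) (l : nat) (A : {fset {vspace 'rV[K]_l}}) L :
  L \notin A -> restriction (L |` A)%fset L = [fset (M :&: L)%VS | M in A]%fset.
Proof. by move=> LA; rewrite /restriction fsetU1K. Qed.

(** Over a finite field A may contain every plane; (4) is then vacuous and (5) fails, hence the
    assumption of a plane outside A for these two. *)
Theorem theorem1p11 (K : fieldType) (strict : bool)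
    (A : {fset {vspace 'rV[K]_3}}) (a b : nat)
    (arrA : is_arrangement A) (essA : essential A) :
  [<-> (* 1 *) free_with_exp A [tuple 1%N; a; b];
       (* 2 *) forall H, H \in A ->
                 (free_deletion A H a b \/ free_deletion A H b a)
                 \/ pog_deletion strict A H a b;
       (* 3 *) exists2 H, H \in A &
                 (free_deletion A H a b \/ free_deletion A H b a)
                 \/ pog_deletion strict A H a b]
  /\
  ((exists2 L : {vspace 'rV[K]_3}, is_hyperplane L & L \notin A) ->
   [<-> (* 1 *) free_with_exp A [tuple 1%N; a; b];
        (* 4 *) forall L, is_hyperplane L -> L \notin A ->
                  (free_addition A L a b \/ free_addition A L b a)
                  \/ pog_addition strict A L a b;
        (* 5 *) exists L, [/\ is_hyperplane L, L \notin A &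
                  (free_addition A L a b \/ free_addition A L b a)
                  \/ pog_addition strict A L a b]]).
Proof.
have nA := essential_neq0 essA.
have coords (H : {vspace 'rV[K]_3}) : is_hyperplane H -> exists i j k : 'I_3,
    [/\ hform H (delta_mx 0 i) != 0, i != j, i != k & j != k].
  move=> hH; have [i ai] := form_coord (hform_neq0 hH).
  by have [j [k [ij ik jk]]] := other_ords3 i; exists i, j, k.
split; last move=> [L0 hL0 L0A]; tfae.
- move=> free H HA; have hH := arrA _ HA; have Ea := lker_hform hH.
  have [i [j [k [ai ij ik jk]]]] := coords H hH.
  have nA' := essential_deletion_neq0 arrA essA HA.
  have HA' : H \notin (A `\ H)%fset by rewrite in_fsetD1 eqxx.
  (* The deletion now plays the role of [A] in the lemmas above, and A that of its union with H. *)
  rewrite -(fsetD1K HA) in free.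
  exact: (deletion_of_free (is_arrangementD1 arrA) nA' hH HA' Ea ai ij ik jk strict free).
- by move=> h; have /fset0Pn[H HA] := nA; exists H => //; apply: h.
- move=> [H HA]; have hH := arrA _ HA; have Ea := lker_hform hH.
  have [i [j [k [ai ij ik jk]]]] := coords H hH.
  have nA' := essential_deletion_neq0 arrA essA HA.
  have HA' : H \notin (A `\ H)%fset by rewrite in_fsetD1 eqxx.
  have arrA' := is_arrangementD1 (H := H) arrA.
  rewrite -[in X in _ -> X](fsetD1K HA).
  have free_case d e : free_deletion A H d e ->
      free_with_exp (H |` A `\ H)%fset [tuple 1%N; d; e].
    move=> [e0 free En]; rewrite -[e in [tuple _; _; e]](prednK e0).
    exact: (free_of_free_deletion arrA' nA' hH HA' Ea ai ij ik jk free En).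
  move=> [[|]/free_case //|pog]; first exact: free_with_exp_swap.
  exact: (free_of_plus_one_generated_deletion arrA' nA' hH HA' Ea ai pog).
- move=> free L hL LA; have Ea := lker_hform hL.
  have [i [j [k [ai ij ik jk]]]] := coords L hL.
  rewrite /free_addition /pog_addition restriction_fset1U //.
  exact: (addition_of_free arrA nA hL LA Ea ai ij ik jk strict free).
- by move=> h; exists L0; split=> //; apply: h.
- move=> [L [hL LA]]; have Ea := lker_hform hL.
  have [i [j [k [ai ij ik jk]]]] := coords L hL.
  rewrite /free_addition /pog_addition restriction_fset1U //.
  have free_case d e : free_with_exp (L |` A)%fset [tuple 1%N; d; e.+1] /\
      #|` [fset (M :&: L)%VS | M in A]%fset| = d.+1 ->
      free_with_exp A [tuple 1%N; d; e].
    by move=> [free En]; apply: (free_of_free_addition arrA nA hL LA Ea ai ij ik jk free).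
  move=> [[|]/free_case //|pog]; first exact: free_with_exp_swap.
  exact: (free_of_plus_one_generated_addition arrA nA hL LA Ea ai ij ik jk pog).
Qed.
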